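(* For every $g\ge1$ there is no non-vanishing cusp form in $[\Gamma_g[2],2]$.
   Context: $\Gamma_g[2]=\ker(\mathrm{Sp}(g,\mathbb Z)\to\mathrm{Sp}(g,\mathbb Z/2\mathbb Z))$ acts on the Siegel half space $\mathcal H_g$ by $M\tau=(A\tau+B)(C\tau+D)^{-1}$. $[\Gamma_g[2],2]$ is the space of Siegel modular forms of weight $2$ on $\Gamma_g[2]$ with trivial character: holomorphic $f$ on $\mathcal H_g$ with $f(M\tau)=\det(C\tau+D)^2f(\tau)$ for all $M\in\Gamma_g[2]$ (with the usual regularity at the cusps when $g=1$). A cusp form is such an $f$ vanishing at all cusps (equivalently, for every $M\in\mathrm{Sp}(g,\mathbb Z)$ the Fourier expansion of $\det(C\tau+D)^{-2}f(M\tau)$ involves only positive definite $T$). *)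

(* Defs.v *)
From HB Require Import structures.
From mathcomp Require Import all_boot all_order all_algebra.
From mathcomp Require Import complex.
From mathcomp Require Import all_classical all_reals all_analysis.
From mathcomp Require summability.

Set Implicit Arguments.
Unset Strict Implicit.
Unset Printing Implicit Defensive.

Import Order.TTheory GRing.Theory Num.Theory.
Import numFieldNormedType.Exports.

Local Open Scope classical_set_scope.
Local Open Scope ring_scope.
Local Open Scope complex_scope.

Section Symplectic.
Variable g : nat.

Definition symplectic_form : 'M[int]_(g + g) :=
  block_mx 0 1%:M (- 1%:M) 0.

Definition Sp : set 'M[int]_(g + g) :=
  [set M | M^T *m symplectic_form *m M = symplectic_form].

Definition Gamma2 : set 'M[int]_(g + g) :=
  [set M | Sp M /\ map_mx (fun z : int => z%:~R : 'F_2) M = 1%:M].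

End Symplectic.

Section PositiveMatrices.
Variables (R : numDomainType) (g : nat).

Definition pos_def (S : 'M[R]_g) : Prop :=
  S^T = S /\ forall v : 'rV[R]_g, v != 0 -> 0 < (v *m S *m v^T) 0 0.

Definition pos_semidef (S : 'M[R]_g) : Prop :=
  S^T = S /\ forall v : 'rV[R]_g, 0 <= (v *m S *m v^T) 0 0.

End PositiveMatrices.

Definition cexp (R : realType) (z : R[i]) : R[i] :=
  (expR (complex.Re z))%:C * (cos (complex.Im z) +i* sin (complex.Im z)).

Section SiegelModularForms.
Variables (R : realType) (g : nat).
Implicit Types (M : 'M[int]_(g + g)) (tau : 'M[R[i]]_g).

Definition siegel_half_space : set 'M[R[i]]_g :=
  [set tau | tau^T = tau /\ pos_def (map_mx (@complex.Im R) tau)].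

Definition intC m n (X : 'M[int]_(m, n)) : 'M[R[i]]_(m, n) :=
  map_mx (fun z : int => z%:~R) X.

Definition automorphy_mx M tau : 'M[R[i]]_g :=
  intC (dlsubmx M) *m tau + intC (drsubmx M).

Definition siegel_act M tau : 'M[R[i]]_g :=
  (intC (ulsubmx M) *m tau + intC (ursubmx M)) *m invmx (automorphy_mx M tau).

Definition slash (k : nat) (f : 'M[R[i]]_g -> R[i]) M tau : R[i] :=
  \det (automorphy_mx M tau) ^- k * f (siegel_act M tau).

Definition sym_of_upper (X : 'M[R[i]]_g) : 'M[R[i]]_g :=
  \matrix_(i, j) (if (i <= j)%N then X i j else X j i).

(* The Siegel half space is open in the space of symmetric matrices, not in
   the space of all matrices, so f is required to be complex differentiable as
   a function of the independent coordinates tau i j with i <= j; its values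
   at non-symmetric matrices play no role. *)
Definition holomorphic_on_siegel (f : 'M[R[i]]_g -> R[i]) : Prop :=
  forall tau, siegel_half_space tau ->
    differentiable (fun X : 'M[(R[i])^o]_g => f (sym_of_upper X) : (R[i])^o)
      (tau : 'M[(R[i])^o]_g).

Definition half_integral (T : 'M[rat]_g) : Prop :=
  [/\ T^T = T, forall i, T i i \is a Num.int
    & forall i j, 2 * T i j \is a Num.int].

(* F(tau) = sum_T a(T) exp(pi i tr(T tau)) on the Siegel half space, the sum
   being unconditionally (equivalently, absolutely) convergent. The exponent
   is pi i and not 2 pi i: a translation tau |-> tau + S lies in Gamma_g[2]
   exactly when S is symmetric with even entries, and the characters of this
   lattice are those indexed by half-integral T. *)
Definition fourier_expansion (F : 'M[R[i]]_g -> R[i])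
    (a : 'M[rat]_g -> R[i]) : Prop :=
  (forall T, a T != 0 -> half_integral T) /\
  forall tau, siegel_half_space tau ->
    summability.partial_sum
      (fun T : 'M[rat]_g =>
         a T * cexp (0 +i* pi * \tr (map_mx ratr T *m tau)) : (R[i])^o)
      @ summability.totally --> (F tau : (R[i])^o).

Definition regular_at_cusps (k : nat) (f : 'M[R[i]]_g -> R[i]) : Prop :=
  forall M, Sp M -> exists2 a, fourier_expansion (slash k f M) a &
    forall T, a T != 0 -> pos_semidef (map_mx ratr T : 'M[R]_g).

Definition modular_form (k : nat) (f : 'M[R[i]]_g -> R[i]) : Prop :=
  [/\ holomorphic_on_siegel f,
      forall M tau, Gamma2 M -> siegel_half_space tau ->
        f (siegel_act M tau) = \det (automorphy_mx M tau) ^+ k * f tau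
    & g = 1%N -> regular_at_cusps k f].

Definition cusp_form (k : nat) (f : 'M[R[i]]_g -> R[i]) : Prop :=
  modular_form k f /\
  forall M, Sp M -> exists2 a, fourier_expansion (slash k f M) a &
    forall T, a T != 0 -> pos_def (map_mx ratr T : 'M[R]_g).

End SiegelModularForms.

(* Main.v *)
Require Import Defs.
From mathcomp Require Import all_boot all_order all_algebra.
From mathcomp Require Import finmap complex ring lra zify.
From mathcomp Require Import all_classical all_reals all_analysis.
From mathcomp Require summability.

Set Implicit Arguments.
Unset Strict Implicit.
Unset Printing Implicit Defensive.

Import Order.TTheory GRing.Theory Num.Theory.
Import numFieldNormedType.Exports.

Local Open Scope classical_set_scope.
Local Open Scope ring_scope.
Local Open Scope complex_scope.

(** For a form f and M in Sp(g, Z) put P(M, tau) = |(f|M)(tau)| det Im tau. It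
    satisfies P(MN, tau) = P(M, N tau) and depends only on M modulo 2; since f
    is a cusp form, reduction theory makes it bounded, by B say.

    If g <= 5, every orbit contains a tau = X + iY with (Y^-1)_gg <= 2.62 < pi:
    make det Y almost maximal, so that Y(u) >= 0.86 for all primitive u, and
    then reduce Y using the bounds A_(i+1) >= 3/4 A_i (Hermite) and
    A_(i+2) >= 2/3 A_i (Korkine-Zolotareff) for successive projected minima.
    Every T in the Fourier expansion has T_gg >= 1, so the maximum principle in
    the variable tau_gg shows that P grows by a factor at least
    exp(pi e) (1 - e (Y^-1)_gg) > 1 when Y_gg is lowered by a small e. This is
    impossible near the supremum of P, unless f = 0.

    If g >= 6, the bound and Bessel's inequality give
    sum_T |a(T)|^2 exp(-2 pi tr(TY)) <= (B / det Y)^2 for every Y. For a fixed T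
    there are L^(g-1) matrices T[U], with U congruent to 1 modulo 2 unipotent,
    on which a takes the value a(T) and tr(T[U] Y) is bounded, where
    Y = diag(L^-2, 1, ..., 1). Hence |a(T)|^2 L^(g-1) is at most a constant times
    L^4, and a(T) = 0 on letting L tend to infinity. *)

(** * Positive definite forms *)

(** Two computations decide where the methods meet. The reduction constants obtained here are 1,
    4/3, 3/2, 2, 9/4 in dimensions one to five, and 9/4 divided by 0.86 is still below pi. The same
    recursion gives 3 in dimension six, where 3 / 0.86 exceeds pi and lowering Y_gg no longer gains.
    The power L^4 is (det Y)^-2, and g - 1 > 4 holds precisely from genus six on.

    P is studied for all M in Sp(g, Z) at once, so that reduction by the full group is available
    although f is modular only at level two.

    Suprema are never shown to be attained. The determinant along an orbit and P are only brought
    close to their suprema, and the constants 0.86 and 2.62 leave room for the loss; no compactness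
    argument is involved. Integrals are avoided in the same spirit: Bessel's inequality and the
    maximum principle are proved for finite sums by averaging over finitely many sample points. They
    pass to the Fourier series because the modulus of a term does not depend on Re tau, so that one
    finite set of T controls the tails for all X simultaneously. *)

Section QuadraticForms.
Variable R : realType.
Implicit Types n : nat.

Definition qf n (Y : 'M[R]_n) (v : 'rV[R]_n) : R := (v *m Y *m v^T) 0 0.

Lemma pos_def_sym n (Y : 'M[R]_n) : pos_def Y -> Y^T = Y.
Proof. by case. Qed.

Lemma pos_def_gt0 n (Y : 'M[R]_n) v : pos_def Y -> v != 0 -> 0 < qf Y v.
Proof. by case=> _; apply. Qed.

Lemma qf0 n (Y : 'M[R]_n) : qf Y 0 = 0.
Proof. by rewrite /qf mul0mx mul0mx mxE. Qed.

Lemma pos_def_ge0 n (Y : 'M[R]_n) v : pos_def Y -> 0 <= qf Y v.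
Proof.
move=> pY; have [->|v0] := eqVneq v 0; first by rewrite qf0.
exact/ltW/pos_def_gt0.
Qed.

Lemma mx11E (A : 'M[R]_1) : A = (A 0 0)%:M.
Proof. by apply/matrixP=> i j; rewrite !ord1 mxE. Qed.

Lemma qf_congr n k (Y : 'M[R]_n) (U : 'M[R]_(k, n)) v :
  qf (U *m Y *m U^T) v = qf Y (v *m U).
Proof. by rewrite /qf trmx_mul !mulmxA. Qed.

Lemma pos_def_congr n (Y U : 'M[R]_n) :
  pos_def Y -> U \in unitmx -> pos_def (U *m Y *m U^T).
Proof.
move=> pY uU; split; first by rewrite !trmx_mul trmxK (pos_def_sym pY) mulmxA.
move=> v v0; rewrite -/(qf _ _) qf_congr; apply: pos_def_gt0 => //.
apply: contra_neq v0 => vU; rewrite -[v]mulmx1 -(mulmxV uU) mulmxA vU.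
by rewrite mul0mx.
Qed.

Lemma qfD n (Y : 'M[R]_n) v w (t : R) : Y^T = Y ->
  qf Y (v + t *: w) = qf Y v + 2 * t * (v *m Y *m w^T) 0 0 + t ^+ 2 * qf Y w.
Proof.
move=> sY; have E : (w *m Y *m v^T) 0 0 = (v *m Y *m w^T) 0 0.
  have -> : v *m Y *m w^T = (w *m Y *m v^T)^T by rewrite !trmx_mul trmxK sY mulmxA.
  by rewrite [RHS]mxE.
rewrite /qf linearD /= linearZ /= !mulmxDl !mulmxDr -!scalemxAl -!scalemxAr.
move: (w *m Y *m v^T) (v *m Y *m w^T) (v *m Y *m v^T) (w *m Y *m w^T) E => p1 p2 p3 p4 E.
by rewrite !mxE E; ring.
Qed.

(* Y in Jacobi form: [qf Y (x, w) = a (x + w u^T)^2 + qf Y2 w]. *)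
Definition jacobi n (a : R) (u : 'rV[R]_n) (Y2 : 'M[R]_n) : 'M[R]_(1 + n) :=
  block_mx a%:M (a *: u) (a *: u^T) (Y2 + a *: (u^T *m u)).

Lemma mul_row_tr n (u w : 'rV[R]_n) : u *m w^T = ((w *m u^T) 0 0)%:M.
Proof. by rewrite [LHS]mx11E -[u]trmxK -trmx_mul trmxK mxE. Qed.

Lemma qf_jacobi n a (u : 'rV[R]_n) Y2 (x : R) w :
  qf (jacobi a u Y2) (row_mx x%:M w) = a * (x + (w *m u^T) 0 0) ^+ 2 + qf Y2 w.
Proof.
rewrite /qf /jacobi mul_row_block tr_row_mx mul_row_col.
rewrite !mulmxDl !mulmxDr !mulmxDl tr_scalar_mx -!scalemxAr -!scalemxAl.
rewrite !mul_scalar_mx -!scalemxAl !mulmxA.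
rewrite -[w *m u^T *m u *m w^T]mulmxA (mul_row_tr u w).
rewrite [w *m u^T]mx11E -!scalar_mxM !scale_scalar_mx.
move: ((w *m u^T) 0 0) (w *m Y2 *m w^T) => t q; rewrite !mxE !eqxx !mulr1n; ring.
Qed.

Lemma row_mx_split n (v : 'rV[R]_(1 + n)) : exists x w, v = row_mx (x%:M) w.
Proof.
exists (v 0 0), (rsubmx v); rewrite -[LHS]hsubmxK; congr row_mx.
by rewrite [LHS]mx11E; congr (_%:M); rewrite mxE; congr (v _ _); apply: val_inj.
Qed.

(** Completing the square: [u] is the rest of the first row divided by the corner [a], and [Y2] is
    the Schur complement of [a]. *)
Lemma jacobi_exists n (Y : 'M[R]_(1 + n)) : pos_def Y ->
  exists a u Y2, [/\ 0 < a, pos_def Y2 & Y = jacobi a u Y2].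
Proof.
move=> pY; have sY := pos_def_sym pY.
pose a := Y 0 0; have a0 : 0 < a.
  have := pos_def_gt0 (v := delta_mx 0 0) pY.
  rewrite /qf -rowE trmx_delta -colE !mxE; apply.
  by apply/eqP=> /matrixP/(_ 0 0); rewrite !mxE !eqxx; apply/eqP/oner_neq0.
pose u := a^-1 *: ursubmx Y.
pose Y2 := drsubmx Y - a *: (u^T *m u).
have EY : Y = jacobi a u Y2.
  rewrite -[LHS]submxK /jacobi /Y2 subrK; congr block_mx.
  - rewrite [LHS]mx11E; congr (_%:M); rewrite !mxE; congr (Y _ _); exact: val_inj.
  - by rewrite /u scalerA divff ?gt_eqF// scale1r.
  - by rewrite /u linearZ /= scalerA divff ?gt_eqF// scale1r trmx_ursub sY.
exists a, u, Y2; split=> //; split.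
  rewrite /Y2 linearB /= linearZ /= trmx_mul trmxK.
  by rewrite trmx_drsub sY.
(* At [x = - w u^T] the square in [qf_jacobi] vanishes and only [qf Y2 w] remains. *)
move=> w w0; have := pos_def_gt0 (v := row_mx (- (w *m u^T) 0 0)%:M w) pY.
rewrite EY qf_jacobi addNr expr0n mulr0 add0r; apply.
apply: contra_neq w0 => E; rewrite -[w](row_mxKr (- (w *m u^T) 0 0)%:M) E.
by apply/matrixP=> i j; rewrite !mxE.
Qed.

(** [V] changes the basis of the projected lattice, while [t] moves the lifts along the first basis
    vector and leaves the projected form alone. *)
Lemma jacobi_congr n a (u : 'rV[R]_n) Y2 (t : 'rV[R]_n) (V : 'M[R]_n) :
  let U := block_mx 1%:M 0 t^T V in
  U *m jacobi a u Y2 *m U^T = jacobi a (u *m V^T + t) (V *m Y2 *m V^T).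
Proof.
rewrite /= /jacobi tr_block_mx !mulmx_block !trmx1 !trmx0 !mul0mx !mul1mx !mulmx0 !mulmx1 !addr0.
rewrite trmxK mul_scalar_mx mul_mx_scalar.
congr block_mx.
- by rewrite -scalemxAl scalerDr addrC.
- by rewrite -scalemxAr linearD /= trmx_mul trmxK scalerDr addrC.
rewrite !linearD /= trmx_mul trmxK.
rewrite !(mulmxDl, mulmxDr, scalerDr) -!(scalemxAl, scalemxAr).
rewrite !mulmxA.
set X1 := a *: (t^T *m t); set X2 := a *: (V *m u^T *m t).
set X3 := a *: (t^T *m u *m V^T); set X4 := V *m Y2 *m V^T.
by rewrite addrC [X1 + X2]addrC [X3 + (X4 + _)]addrCA [X3 + _]addrC -addrA.
Qed.

Lemma det_jacobi n a (u : 'rV[R]_n) Y2 : \det (jacobi a u Y2) = a * \det Y2.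
Proof.
have := jacobi_congr a 0 Y2 u 1%:M; rewrite /= mul0mx add0r mul1mx trmx1 mulmx1.
move=> <-; rewrite !det_mulmx det_tr det_lblock !det1 !mulr1 mul1r.
by rewrite /jacobi trmx0 mul0mx !scaler0 addr0 det_ublock det_scalar1.
Qed.

Lemma mulV_jacobi n a (u : 'rV[R]_n) Y2 : a != 0 -> Y2 \in unitmx ->
  let Z := invmx Y2 in
  invmx (jacobi a u Y2) =
  block_mx (a^-1%:M + u *m Z *m u^T) (- (u *m Z)) (- (Z *m u^T)) Z.
Proof.
move=> a0 uY /=; set B := block_mx _ _ _ _.
suff E : jacobi a u Y2 *m B = 1%:M.
  have [uJ _] := mulmx1_unit E.
  by rewrite -[RHS](mulKmx uJ) E mulmx1.
rewrite /jacobi /B mulmx_block.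
rewrite (scalar_mx_block 1 n 1).
congr block_mx.
- rewrite mulmxDr mul_scalar_mx mul_scalar_mx mulmxN -scalemxAl mulmxA addrK.
  by rewrite scale_scalar_mx divff.
- by rewrite mulmxN mul_scalar_mx -scalemxAl addNr.
- rewrite mulmxDr mul_mx_scalar scalerA mulVf// scale1r mulmxN mulmxDl.
  rewrite [Y2 *m (_ *m _)]mulmxA mulmxV// mul1mx -!scalemxAl !mulmxA opprD addrACA subrr add0r.
  by rewrite subrr.
- rewrite mulmxN mulmxDl mulmxV// -!scalemxAl !mulmxA addrCA addNr addr0 //.
Qed.

Lemma cholesky n (Y : 'M[R]_n) : pos_def Y ->
  exists2 L : 'M[R]_n, L \in unitmx & Y = L *m L^T.
Proof.
elim: n Y => [|n IH] Y pY.
  by exists 1%:M; rewrite ?unitmx1//; apply/matrixP=> -[].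
have [a [u [Y2 [a0 p2 ->]]]] := jacobi_exists (n := n) pY.
have [K uK EK] := IH _ p2.
pose s := Num.sqrt a.
have ss : s * s = a by rewrite -expr2 sqr_sqrtr// ltW.
have s0 : s != 0 by rewrite gt_eqF// sqrtr_gt0.
exists (block_mx (s%:M : 'M[R]_1) 0 (s *: u^T) K).
  rewrite unitmxE (@det_lblock _ 1 n) det_scalar1 unitrM unitfE s0 /=.
  by rewrite -unitmxE.
rewrite /jacobi (@tr_block_mx _ 1 n 1 n) (@mulmx_block _ 1 n 1 n 1 n) trmx0 !mul0mx !mulmx0 !addr0.
rewrite tr_scalar_mx linearZ /= trmxK -scalar_mxM ss.
rewrite -!scalemxAl -!scalemxAr mul_scalar_mx mul_mx_scalar !scalerA ss EK.
by rewrite addrC.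
Qed.

Lemma pos_def_unit n (Y : 'M[R]_n) : pos_def Y -> Y \in unitmx.
Proof. by move=> /cholesky[L uL ->]; rewrite unitmx_mul unitmx_tr uL. Qed.

Lemma pos_def_det n (Y : 'M[R]_n) : pos_def Y -> 0 < \det Y.
Proof.
move=> /cholesky[L uL ->]; rewrite det_mulmx det_tr -expr2.
by rewrite exprn_even_gt0//= -unitfE -unitmxE.
Qed.

Lemma pos_def_inv n (Y : 'M[R]_n) : pos_def Y -> pos_def (invmx Y).
Proof.
move=> pY; have uY := pos_def_unit pY.
have := pos_def_congr (U := invmx Y) pY.
by rewrite unitmx_inv trmx_inv pos_def_sym// mulVmx// mul1mx; exact.
Qed.

Lemma qf_delta n (Y : 'M[R]_n) i : qf Y (delta_mx 0 i) = Y i i.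
Proof. by rewrite /qf -rowE trmx_delta -colE !mxE. Qed.

Lemma pos_def_diag n (Y : 'M[R]_n) i : pos_def Y -> 0 < Y i i.
Proof.
move=> pY; rewrite -qf_delta pos_def_gt0//.
by apply/eqP=> /matrixP/(_ 0 i); rewrite !mxE !eqxx; apply/eqP/oner_neq0.
Qed.

(** Cauchy-Schwarz for the form [Y], applied to [v] and the dual vector [w = e_i Y^-1], which pairs
    with [v] to its i-th coordinate and has [qf Y w = (Y^-1)_ii]. *)
Lemma coord_le n (Y : 'M[R]_n) (v : 'rV[R]_n) (i : 'I_n) : pos_def Y ->
  (v 0 i) ^+ 2 <= qf Y v * invmx Y i i.
Proof.
move=> pY; have pI := pos_def_inv pY; have uY := pos_def_unit pY.
have d0 := pos_def_diag i pI; set d := invmx Y i i in d0 *.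
pose w := delta_mx 0 i *m invmx Y : 'rV_n.
have Ew : qf Y w = d.
  by rewrite -qf_congr trmx_inv pos_def_sym// mulVmx// mul1mx qf_delta.
have := pos_def_ge0 (v + (- (v 0 i / d)) *: w) pY.
rewrite qfD ?pos_def_sym// Ew.
have -> : (v *m Y *m w^T) 0 0 = v 0 i.
  rewrite /w trmx_mul trmx_inv pos_def_sym// mulmxA mulmxK//.
  by rewrite trmx_delta -colE mxE.
set q := qf Y v; set x := v 0 i => H.
have -> : q * d = (q + 2 * (- (x / d)) * x + (- (x / d)) ^+ 2 * d) * d + x ^+ 2.
  by field; rewrite gt_eqF.
by rewrite lerDr mulr_ge0// ltW.
Qed.

Definition sqnorm n (v : 'rV[R]_n) : R := \sum_i (v 0 i) ^+ 2.

Lemma sqnorm_ge0 n (v : 'rV[R]_n) : 0 <= sqnorm v.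
Proof. by apply: sumr_ge0 => i _; exact: sqr_ge0. Qed.

Lemma sqnorm_le n (Y : 'M[R]_n) v : pos_def Y ->
  sqnorm v <= qf Y v * \tr (invmx Y).
Proof.
move=> pY; rewrite /mxtrace mulr_sumr; apply: ler_sum => i _.
exact: coord_le.
Qed.

Lemma mxtrace_congr n (T L : 'M[R]_n) :
  \tr (T *m (L *m L^T)) = \sum_i qf T (row i L^T).
Proof.
rewrite mulmxA mxtrace_mulC mulmxA /mxtrace; apply: eq_bigr => i _.
by rewrite -qf_delta -{2}[L]trmxK qf_congr -rowE.
Qed.

Lemma tr_mul_ge0 n (T Y : 'M[R]_n) :
  pos_semidef T -> pos_def Y -> 0 <= \tr (T *m Y).
Proof.
move=> [_ pT] /cholesky[L uL ->]; rewrite mxtrace_congr.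
by apply: sumr_ge0 => i _; exact: pT.
Qed.

(** A weak form of the inequality between arithmetic and geometric means; later only the exponent
    counts, not the constant. *)
Lemma det_le_tr n (A : 'M[R]_n) : pos_def A -> \det A <= (\tr A) ^+ n.
Proof.
elim: n A => [|n IH] A pA; first by rewrite det_mx00.
have [a [u [Y2 [a0 p2 ->]]]] := jacobi_exists (n := n) pA.
rewrite det_jacobi /jacobi (@mxtrace_block _ 1 n) linearD /= linearZ /=.
have t0 : 0 <= \tr Y2.
  by apply: sumr_ge0 => i _; exact/ltW/pos_def_diag.
have q0 : 0 <= a * \tr (u^T *m u).
  apply: mulr_ge0; first exact: ltW.
  rewrite mxtrace_mulC; apply: sumr_ge0 => i _.
  by rewrite ord1 mxE; apply: sumr_ge0 => j _; rewrite mxE -expr2 sqr_ge0.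
have -> : \tr (a%:M : 'M[R]_1) = a by rewrite mxtrace_scalar mulr1n.
set q := a * _ in q0 *; rewrite exprS.
apply: ler_pM => //; first exact: ltW.
- exact/ltW/pos_def_det.
- by rewrite lerDl addr_ge0.
- apply: le_trans (IH _ p2) _; by apply: lerXn2r; rewrite ?nnegrE//; move: t0 q0 a0; lra.
Qed.

(** With [B = L L^T], the matrix [L^T A L] is positive definite, has the trace of [A B] and the
    determinant [det A det B]. *)
Lemma det_mul_le_tr n (A B : 'M[R]_n) : pos_def A -> pos_def B ->
  \det A * \det B <= (\tr (A *m B)) ^+ n.
Proof.
move=> pA /cholesky[L uL ->]; rewrite mulmxA mxtrace_mulC mulmxA.
have p : pos_def (L^T *m A *m L).
  by rewrite -{2}[L]trmxK; apply: pos_def_congr; rewrite ?unitmx_tr.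
apply: le_trans (det_le_tr p).
by rewrite !det_mulmx det_tr [leRHS]mulrAC mulrC.
Qed.

Lemma tr_mul_le n (T Y1 Y2 : 'M[R]_n) : pos_semidef T ->
  pos_def (Y2 - Y1) -> \tr (T *m Y1) <= \tr (T *m Y2).
Proof.
by move=> pT pY; rewrite -subr_ge0 -linearB -mulmxBr; exact: tr_mul_ge0.
Qed.

Lemma pos_def_semidef n (T : 'M[R]_n) : pos_def T -> pos_semidef T.
Proof. by move=> pT; split=> [|v]; [case: pT | exact: pos_def_ge0]. Qed.

Lemma qfB n (Y1 Y2 : 'M[R]_n) v : qf (Y1 - Y2) v = qf Y1 v - qf Y2 v.
Proof. by rewrite /qf mulmxBr mulmxBl !mxE. Qed.

Lemma qfZl n (Y : 'M[R]_n) c v : qf (c *: Y) v = c * qf Y v.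
Proof. by rewrite /qf -scalemxAr -scalemxAl mxE. Qed.

Lemma qf1 n (v : 'rV[R]_n) : qf 1%:M v = sqnorm v.
Proof.
by rewrite /qf mulmx1 mxE; apply: eq_bigr => i _; rewrite mxE expr2.
Qed.

Lemma qf_scalar n c (v : 'rV[R]_n) : qf c%:M v = c * sqnorm v.
Proof. by rewrite -scalemx1 qfZl qf1. Qed.

Lemma qf_delta_mx n i (v : 'rV[R]_n) : qf (delta_mx i i) v = (v 0 i) ^+ 2.
Proof.
rewrite /qf -(mul_delta_mx (0 : 'I_1)) mulmxA -mulmxA -colE.
by rewrite mxE big_ord1 -rowE !mxE expr2.
Qed.

Lemma sqnorm_gt0 n (v : 'rV[R]_n) : v != 0 -> 0 < sqnorm v.
Proof.
move=> v0; rewrite lt_neqAle sqnorm_ge0 andbT eq_sym; apply: contra_neq v0.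
move=> /psumr_eq0P H; apply/rowP=> i; rewrite mxE; apply/eqP.
by rewrite -sqrf_eq0 H// => j _; exact: sqr_ge0.
Qed.

Lemma pos_def_sub_scalar n (Y : 'M[R]_n) c : pos_def Y ->
  c * \tr (invmx Y) < 1 -> pos_def (Y - c%:M).
Proof.
move=> pY H; split; first by rewrite linearB /= tr_scalar_mx pos_def_sym.
move=> v v0; rewrite -/(qf _ _) qfB qf_scalar subr_gt0.
have q0 := pos_def_gt0 pY v0; have s0 := sqnorm_ge0 v.
have [c0|c0] := leP c 0.
  by apply: le_lt_trans q0; rewrite mulr_le0_ge0.
apply: le_lt_trans (_ : c * (qf Y v * \tr (invmx Y)) < _).
  by rewrite ler_pM2l// sqnorm_le.
by rewrite mulrCA gtr_pMr.
Qed.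

Lemma pos_def_sub_delta n (Y : 'M[R]_n) c i : pos_def Y ->
  c * invmx Y i i < 1 -> pos_def (Y - c *: delta_mx i i).
Proof.
move=> pY H; split; first by rewrite linearB /= linearZ /= trmx_delta pos_def_sym.
move=> v v0; rewrite -/(qf _ _) qfB qfZl qf_delta_mx subr_gt0.
have q0 := pos_def_gt0 pY v0; have s0 := sqr_ge0 (v 0 i).
have [c0|c0] := leP c 0.
  by apply: le_lt_trans q0; rewrite mulr_le0_ge0.
apply: le_lt_trans (_ : c * (qf Y v * invmx Y i i) < _).
  by rewrite ler_pM2l// coord_le.
by rewrite mulrCA gtr_pMr.
Qed.

(** The determinant is affine in its entry [(i, i)], with slope the cofactor [det Y (Y^-1)_ii]. This
    is the loss that the descent in [tau_gg] has to outweigh. *)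
Lemma det_sub_delta n (Y : 'M[R]_n) c i : Y \in unitmx ->
  \det (Y - c *: delta_mx i i) = \det Y * (1 - c * invmx Y i i).
Proof.
move=> uY; have d0 : \det Y != 0 by rewrite -unitfE -unitmxE.
have -> : \det (Y - c *: delta_mx i i) = \det Y - c * cofactor Y i i.
  have rE j : row' i (col' j (Y - c *: delta_mx i i)) = row' i (col' j Y).
    by apply/matrixP=> k l; rewrite !mxE [_ == i]eq_sym (negbTE (neq_lift i k)) /= mulr0 subr0.
  have cE j : cofactor (Y - c *: delta_mx i i) i j = cofactor Y i j.
    by rewrite /cofactor rE.
  rewrite (expand_det_row _ i) (expand_det_row Y i).
  under eq_bigr => j _ do rewrite cE !mxE mulrBl eqxx.
  rewrite sumrB; congr (_ - _); rewrite (bigD1 i)//= eqxx big1 ?addr0 ?mulr1//.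
  by move=> j /negbTE ->; rewrite mulr0 mul0r.
rewrite /invmx uY !mxE; field; exact: d0.
Qed.

End QuadraticForms.

(** * Reduction of integral lattices *)

Section Reduction.
Variable R : realType.
Implicit Types n : nat.

Definition intmx m n (U : 'M[int]_(m, n)) : 'M[R]_(m, n) := map_mx intr U.

Lemma intmxM m n p (U : 'M[int]_(m, n)) (V : 'M[int]_(n, p)) :
  intmx (U *m V) = intmx U *m intmx V.
Proof. exact: map_mxM. Qed.

Lemma intmx_tr m n (U : 'M[int]_(m, n)) : intmx U^T = (intmx U)^T.
Proof. by rewrite /intmx map_trmx. Qed.

Lemma intmx_unit n (U : 'M[int]_n) : U \in unitmx -> intmx U \in unitmx.
Proof.
move=> uU; apply: (@proj1 _ _ (mulmx1_unit (B := intmx (invmx U)) _)).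
by rewrite -intmxM mulmxV// /intmx map_mx1.
Qed.

Lemma intmx_row n (t : int) (v : 'rV[int]_n) :
  intmx (row_mx t%:M v) = row_mx (t%:~R)%:M (intmx v).
Proof. by rewrite /intmx map_row_mx map_scalar_mx. Qed.

Lemma intmx_eq0 n (v : 'rV[int]_n) : intmx v = 0 -> v = 0.
Proof.
move=> /rowP H; apply/rowP=> i; have := H i; rewrite !mxE => /eqP.
by rewrite intr_eq0 => /eqP.
Qed.

(** The primitive vectors of [Z^n], encoded by a basis containing them, so that a shortest one can
    be moved to the first position at once. *)
Definition unimodular_row n (v : 'rV[int]_n) : Prop :=
  exists2 U : 'M[int]_n, U \in unitmx & exists i, v = row i U.

Lemma unimodular_row_mul n (v : 'rV[int]_n) V :
  unimodular_row v -> V \in unitmx -> unimodular_row (v *m V).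
Proof.
move=> [U uU [i ->]] uV; exists (U *m V); first by rewrite unitmx_mul uU.
by exists i; rewrite row_mul.
Qed.

Lemma unimodular_row_lift n t (v : 'rV[int]_n) :
  unimodular_row v -> unimodular_row (row_mx t%:M v).
Proof.
move=> [U uU [i ->]].
exists (block_mx (1%:M : 'M[int]_1) 0 (const_mx t) U).
  by rewrite unitmxE det_lblock det1 mul1r -unitmxE.
exists (rshift 1 i); rewrite /block_mx rowKd row_row_mx; congr row_mx.
by apply/rowP=> j; rewrite !mxE ord1.
Qed.

Lemma unimodular_row_first n t :
  unimodular_row (row_mx 1%:M (t : 'rV[int]_n)).
Proof.
exists (block_mx (1%:M : 'M[int]_1) t 0 1%:M).
  by rewrite unitmxE det_ublock !det1 mul1r.
exists (lshift n 0); rewrite /block_mx rowKu row_row_mx.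
by congr row_mx; apply/rowP=> j; rewrite !mxE ?ord1.
Qed.

Definition lower_bound n (m : R) (Y : 'M[R]_n) : Prop :=
  forall v, unimodular_row v -> m <= qf Y (intmx v).

Lemma lower_bound_congr n m (Y : 'M[R]_n) U : U \in unitmx ->
  lower_bound m Y -> lower_bound m (intmx U *m Y *m (intmx U)^T).
Proof.
move=> uU H v uv; rewrite qf_congr -intmxM; apply: H.
exact: unimodular_row_mul.
Qed.

Lemma lower_bound_le n m m' (Y : 'M[R]_n) :
  m' <= m -> lower_bound m Y -> lower_bound m' Y.
Proof. by move=> mm H v uv; apply: le_trans mm (H v uv). Qed.

Lemma fin_argmin (T : finType) (P : T -> Prop) (F : T -> R) (t0 : T) :
  P t0 -> exists2 t, P t & forall s, P s -> F t <= F s.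
Proof.
move=> Pt0; have b0 : (fun t => `[< P t >]) t0 by exact/asboolP.
case: (@arg_minP _ _ _ t0 (fun t => `[< P t >]) F b0) => t /asboolP Pt Ht; exists t => // s Ps.
by apply: Ht; exact/asboolP.
Qed.

(** By [coord_le], the integral vectors on which [Y] does not exceed its value at the first basis
    vector lie in a finite box, over which a minimum exists. *)
Lemma min_row n (Y : 'M[R]_n.+1) : pos_def Y ->
  exists2 v, unimodular_row v &
    forall w, unimodular_row w -> qf Y (intmx v) <= qf Y (intmx w).
Proof.
move=> pY.
pose v0 : 'rV[int]_n.+1 := row 0 1%:M.
have uv0 : unimodular_row v0 by exists 1%:M; rewrite ?unitmx1//; exists 0.
pose q0 := qf Y (intmx v0).
pose K := (Num.truncn (q0 * \tr (invmx Y))).+1.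
have small (w : 'rV[int]_n.+1) (i : 'I_n.+1) : qf Y (intmx w) <= q0 -> (absz (w ord0 i) < K)%N.
  move=> wq; have d0 j := pos_def_diag j (pos_def_inv pY).
  have : (w 0 i)%:~R ^+ 2 <= q0 * \tr (invmx Y).
    have := coord_le (intmx w) i pY; rewrite mxE => /le_trans; apply.
    rewrite ler_pM ?pos_def_ge0 ?(ltW (d0 i))//.
    rewrite /mxtrace (bigD1 i)//= lerDl; apply: sumr_ge0 => j _; exact: ltW.
  move=> H; have := truncnS_gt (q0 * \tr (invmx Y)); rewrite -/K => HK.
  have : (absz (w ord0 i) * absz (w ord0 i))%N%:R < K%:R :> R.
    apply: le_lt_trans HK; apply: le_trans H.
    by rewrite natrM !natr_absz !intr_norm -normrM ger0_norm -expr2 ?sqr_ge0.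
  have sq (x L : nat) : (x * x < L -> x < L)%N.
    have [->|x0] := posnP x; first by lia.
    by move=> h; apply: leq_trans h; rewrite ltnS leq_pmulr.
  by rewrite ltr_nat => /sq.
(* Coordinates of absolute value below [K] are shifted by [K] to become elements of ['I_(K + K)]. *)
pose dec (t : {ffun 'I_n.+1 -> 'I_(K + K)}) : 'rV[int]_n.+1 :=
  \row_i ((t i : nat)%:Z - K%:Z).
pose enc (w : 'rV[int]_n.+1) : {ffun 'I_n.+1 -> 'I_(K + K)} :=
  [ffun i => inord (absz (w 0 i + K%:Z))].
have encK w : qf Y (intmx w) <= q0 -> dec (enc w) = w.
  move=> wq; apply/rowP=> i; rewrite mxE ffunE.
  have enc_int (x : int) (L : nat) : (absz x < L)%N ->
      (absz (x + L%:Z)%R < L + L)%N /\ (absz (x + L%:Z))%:Z - L%:Z = x.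
    by move=> xL; split; lia.
  by have [lt eq] := enc_int _ _ (small w i wq); rewrite inordK.
have [t Pt Ht] := @fin_argmin _ (fun t => unimodular_row (dec t))
  (fun t => qf Y (intmx (dec t))) (enc v0) (eq_ind_r _ uv0 (encK v0 (lexx _))).
exists (dec t) => // w uw; have [wq|wq] := leP (qf Y (intmx w)) q0.
  by have := Ht (enc w); rewrite (encK w wq); exact.
apply/ltW/(le_lt_trans _ wq).
by have := Ht (enc v0); rewrite (encK v0 (lexx _)); exact.
Qed.

(** * The inequalities of Hermite and of Korkine and Zolotareff *)

Lemma int_round (x : R) : exists t : int, `|x + t%:~R| <= 1 / 2.
Proof.
pose k := Num.floor (x + 1 / 2); exists (- k).
have /andP[] := floor_itv (x + 1 / 2); rewrite -/k intrD rmorphN /= ler_norml.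
by move: (k%:~R : R) => y; lra.
Qed.

(** A basis change of the projected lattice extends to the whole lattice, and the freedom in
    choosing integral lifts is spent on making the entries of [u'] at most 1/2. *)
Lemma lift_row n a u (Y2 : 'M[R]_n) (V : 'M[int]_n) : V \in unitmx ->
  exists2 U : 'M[int]_(1 + n), U \in unitmx &
  exists2 u' : 'rV[R]_n, (forall i, `|u' 0 i| <= 1 / 2) &
    intmx U *m jacobi a u Y2 *m (intmx U)^T
    = jacobi a u' (intmx V *m Y2 *m (intmx V)^T).
Proof.
move=> uV; pose w := u *m (intmx V)^T.
have [t Ht] := choice (fun i => int_round (w 0 i)).
exists (block_mx 1%:M 0 (\row_i t i)^T V).
  by rewrite unitmxE det_lblock det1 mul1r -unitmxE.
exists (w + intmx (\row_i t i)); first by move=> i; rewrite mxE [intmx _ _ _]mxE mxE; exact: Ht.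
rewrite /w -jacobi_congr; congr (_ *m _ *m _^T);
by rewrite /intmx map_block_mx map_mx1 map_mx0 map_trmx.
Qed.

Lemma jacobi_diag0 n a (u : 'rV[R]_n) Y2 : jacobi a u Y2 0 0 = a.
Proof.
have -> : (0 : 'I_(1 + n)) = lshift n 0 by apply: val_inj.
by rewrite block_mxEul mxE eqxx mulr1n.
Qed.

Lemma first_min n (Y : 'M[R]_(1 + n)) : pos_def Y ->
  exists2 U, U \in unitmx & exists a u Y2,
    [/\ 0 < a, pos_def Y2,
        intmx U *m Y *m (intmx U)^T = jacobi a u Y2
      & lower_bound a (jacobi a u Y2)].
Proof.
move=> pY; have [v [U uU [i vE]] vmin] := @min_row n _ pY.
pose W := tperm_mx 0 i *m U : 'M[int]_(1 + n).
have uW : W \in unitmx by rewrite unitmx_mul unitmx_perm uU.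
have [a [u [Y2 [a0 p2 E]]]] := jacobi_exists (pos_def_congr pY (intmx_unit uW)).
exists W => //; exists a, u, Y2; split=> //.
rewrite -E; apply: lower_bound_congr => // w uw.
suff -> : a = qf Y (intmx v) by exact: vmin.
have := jacobi_diag0 a u Y2; rewrite -E -qf_delta qf_congr => <-; congr qf.
rewrite -rowE /intmx -map_row; congr map_mx.
by rewrite vE /W -xrowE; apply/rowP=> j; rewrite !mxE perm.tpermL.
Qed.

(** Lift a primitive vector [v] of the projected lattice with first component at most 1/2 in
    absolute value; minimality of [a] then gives [a <= a / 4 + qf Y2 v]. *)
Lemma lower_bound_tail n a u (Y2 : 'M[R]_n) :
  0 < a -> lower_bound a (jacobi a u Y2) -> lower_bound (3 / 4 * a) Y2.
Proof.
move=> a0 H v uv; have [t Ht] := int_round ((intmx v *m u^T) 0 0).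
have := H _ (unimodular_row_lift t uv).
rewrite intmx_row qf_jacobi [_%:~R + _]addrC => H1.
have : ((intmx v *m u^T) 0 0 + t%:~R) ^+ 2 <= 1 / 4.
  by rewrite -real_normK ?num_real//; move: (normr_ge0 ((intmx v *m u^T) 0 0 + t%:~R)) Ht; nra.
by move: H1; move: (_ ^+ 2) => x; nra.
Qed.

(* If [c < 2/3 a] then [al] and [`|be|] both exceed [5/6 - ga], so that [d] is small. *)
Lemma korkine_zolotareff_reduced (a b c al be ga d : R) :
  0 < a -> 0 < b -> 0 <= al <= 1 / 2 -> `|be| <= 1 / 2 -> 0 <= ga <= 1 / 2 ->
  d = (if 0 <= be then be - al else 1 - al + be) ->
  a <= a * al ^+ 2 + b -> b <= b * ga ^+ 2 + c ->
  a <= a * be ^+ 2 + b * ga ^+ 2 + c ->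
  a <= a * d ^+ 2 + b * (1 - ga) ^+ 2 + c ->
  2 / 3 * a <= c.
Proof.
move=> a0 b0 /andP[al0 al1] be1 /andP[ga0 ga1] dE H1 H2 H3 H4.
(* For [ga <= 1/3] two Hermite steps suffice: [c >= 8/9 b] and [b >= 3/4 a], with product 2/3. *)
have [ga3|ga3] := leP ga (1 / 3).
  have : ga ^+ 2 <= 1 / 9 by nra.
  have : al ^+ 2 <= 1 / 4 by nra.
  by nra.
rewrite leNgt; apply/negP => cl.
have g2 : ga ^+ 2 <= 1 / 4 by nra.
(* The product [(1 - (5/6 - ga)^2) (1 - ga^2)] equals 2/3 at both ends [ga = 1/3] and [ga = 1/2] and
   is at least 2/3 between them, which explains the threshold [5/6 - ga]. *)
have key x : 0 <= x -> (1 - x ^+ 2) * (1 - ga ^+ 2) < 2 / 3 -> 5 / 6 - ga < x.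
  move=> x0 Hx; rewrite ltNge; apply/negP => xl.
  have : x ^+ 2 <= (5 / 6 - ga) ^+ 2 by rewrite lerXn2r ?nnegrE//; lra.
  move=> x2.
  have : (1 - (5 / 6 - ga) ^+ 2) * (1 - ga ^+ 2) <= (1 - x ^+ 2) * (1 - ga ^+ 2).
    by rewrite ler_pM2r; lra.
  have : 0 <= (ga - 1 / 3) * (1 / 2 - ga) by rewrite mulr_ge0; lra.
  set p := (ga - 1 / 3) * _ => p0.
  have -> : (1 - (5 / 6 - ga) ^+ 2) * (1 - ga ^+ 2)
     = 2 / 3 + p * (13 / 6 + (ga * (5 / 6 - ga))) by rewrite /p; field.
  have : 0 <= p * (13 / 6 + (ga * (5 / 6 - ga))).
    by rewrite mulr_ge0// addr_ge0 ?mulr_ge0//; lra.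
  by move: Hx; lra.
have k1 : 5 / 6 - ga < al.
  apply: key => //; rewrite -(ltr_pM2l a0).
  apply: le_lt_trans (_ : b * (1 - ga ^+ 2) < _).
    by rewrite mulrA ler_pM2r; nra.
  by nra.
have k2 : 5 / 6 - ga < `|be|.
  apply: key => //; rewrite real_normK ?num_real// -(ltr_pM2l a0).
  have : a * (1 - be ^+ 2) <= b * ga ^+ 2 + c by nra.
  move=> h; apply: le_lt_trans (_ : (b * ga ^+ 2 + c) * (1 - ga ^+ 2) < _).
    by rewrite mulrA ler_pM2r; lra.
  have : b * (1 - ga ^+ 2) * ga ^+ 2 <= c * ga ^+ 2.
    by rewrite ler_wpM2r ?sqr_ge0//; lra.
  by nra.
(* Both [al] and [|be|] lie between [5/6 - ga] and 1/2. For [be >= 0] their difference is at most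
   [ga - 1/3]; otherwise [d = 1 - al - |be|] lies between 0 and [2 ga - 2/3]. *)
have d2 : d ^+ 2 <= (2 * ga - 2 / 3) ^+ 2.
  have : 0 <= 2 * ga - 2 / 3 by lra.
  have : `|d| <= 2 * ga - 2 / 3.
    rewrite dE ler_norml; move: k2 be1; have [b1|b1] := leP 0 be.
      by rewrite ger0_norm//; lra.
    by rewrite ltr0_norm//; lra.
  by rewrite -[d ^+ 2]real_normK ?num_real//; move: (normr_ge0 d); nra.
have h5 : a * (1 - d ^+ 2) * (1 + ga) <= 2 * c.
  have h6 : b * (1 - ga) * (1 + ga) <= c by nra.
  have h7 : b * (1 - ga) * (1 + ga) * (1 - ga) <= c * (1 - ga).
    by rewrite ler_wpM2r//; lra.
  have h8 : a * (1 - d ^+ 2) * (1 + ga) <= (b * (1 - ga) ^+ 2 + c) * (1 + ga).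
    by rewrite ler_wpM2r//; lra.
  by nra.
have h9 : a * ((1 - (2 * ga - 2 / 3) ^+ 2) * (1 + ga)) <= a * (1 - d ^+ 2) * (1 + ga).
  by rewrite mulrA ler_wpM2r ?ler_wpM2l//; lra.
(* This product is the excess of [(1 - (2 ga - 2/3)^2) (1 + ga)] over 4/3; with [h5] and [h9] it
   yields [4/3 a <= 2 c]. *)
have : 0 <= a * ((ga - 1 / 3) * (1 / 2 - ga) * (4 * ga + 14 / 3)).
  by rewrite !mulr_ge0//; lra.
have -> : (ga - 1 / 3) * (1 / 2 - ga) * (4 * ga + 14 / 3) =
  (1 - (2 * ga - 2 / 3) ^+ 2) * (1 + ga) - 4 / 3 by field.
by rewrite mulrBr; lra.
Qed.

(** Integral shifts and sign changes of the three basis vectors preserve the hypotheses and bring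
    [al], [be], [ga] into the ranges of [korkine_zolotareff_reduced]. *)
Lemma korkine_zolotareff (a b c al be ga : R) : 0 < a -> 0 < b ->
  (forall x : int, a <= a * (x%:~R + al) ^+ 2 + b) ->
  (forall y : int, b <= b * (y%:~R + ga) ^+ 2 + c) ->
  (forall x y : int,
     a <= a * (x%:~R + y%:~R * al + be) ^+ 2 + b * (y%:~R + ga) ^+ 2 + c) ->
  2 / 3 * a <= c.
Proof.
move=> a0 b0 H1 H2 H3.
wlog : ga be H2 H3 / 0 <= ga <= 1 / 2.
  move=> W; have [y Hy] := int_round ga.
  have [g0|g0] := leP 0 (ga + y%:~R).
    apply: (W (ga + y%:~R) (be + y%:~R * al)).
    - by move=> z; have := H2 (z + y); rewrite intrD addrAC -addrA.
    - move=> x z; have := H3 x (z + y); rewrite !intrD.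
      by move=> h; apply: (le_trans h); rewrite le_eqVlt; apply/orP; left; apply/eqP; ring.
    - by rewrite g0 -(ger0_norm g0).
  apply: (W (- (ga + y%:~R)) (- (be + y%:~R * al))).
  - move=> z; have := H2 (y - z); rewrite !intrD rmorphN /=.
    by move=> h; apply: (le_trans h); rewrite le_eqVlt; apply/orP; left; apply/eqP; ring.
  - move=> x z; have := H3 (- x) (y - z); rewrite !intrD !rmorphN /=.
    by move=> h; apply: (le_trans h); rewrite le_eqVlt; apply/orP; left; apply/eqP; ring.
  - by rewrite oppr_ge0 ltW//= -(ltr0_norm g0).
move=> ga01.
wlog : al be H1 H3 / 0 <= al <= 1 / 2.
  move=> W; have [x Hx] := int_round al.
  have [g0|g0] := leP 0 (al + x%:~R).
    apply: (W (al + x%:~R) be).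
    - by move=> z; have := H1 (z + x); rewrite intrD addrAC -addrA.
    - move=> z y; have := H3 (z + x * y) y; rewrite !intrD intrM.
      by move=> h; apply: (le_trans h); rewrite le_eqVlt; apply/orP; left; apply/eqP; ring.
    - by rewrite g0 -(ger0_norm g0).
  apply: (W (- (al + x%:~R)) (- be)).
  - move=> z; have := H1 (x - z); rewrite !intrD rmorphN /=.
    by move=> h; apply: (le_trans h); rewrite le_eqVlt; apply/orP; left; apply/eqP; ring.
  - move=> z y; have := H3 (x * y - z) y; rewrite !intrD !rmorphN intrM /=.
    by move=> h; apply: (le_trans h); rewrite le_eqVlt; apply/orP; left; apply/eqP; ring.
  - by rewrite oppr_ge0 ltW//= -(ltr0_norm g0).
move=> al01.
wlog be2 : be H3 / `|be| <= 1 / 2.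
  move=> W; have [x Hx] := int_round be.
  apply: (W (be + x%:~R)) => // z y; have := H3 (z + x) y; rewrite intrD.
  by move=> h; apply: (le_trans h); rewrite le_eqVlt; apply/orP; left; apply/eqP; ring.
apply: (korkine_zolotareff_reduced a0 b0 al01 be2 ga01 erefl).
- by have := H1 0; rewrite mulr0z add0r.
- by have := H2 0; rewrite mulr0z add0r.
- by have := H3 0 0; rewrite mulr0z mul0r !add0r.
(* The last inequality is the vector with [y = -1], and with [x = 0] or [x = 1] according to the
   sign of [be], as in the definition of [d]. *)
have [b1|b1] := leP 0 be.
  have := H3 0 (-1); rewrite rmorphN /= => h; apply: (le_trans h).
  by rewrite le_eqVlt; apply/orP; left; apply/eqP; ring.
have := H3 1 (-1); rewrite rmorphN /= => h; apply: (le_trans h).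
by rewrite le_eqVlt; apply/orP; left; apply/eqP; ring.
Qed.

(** For each [w] the question concerns only the rank three lattice spanned by the first two basis
    vectors and a lift of [w], all of whose relevant vectors are primitive in the large lattice. *)
Lemma lower_bound_tail2 n a u b s (Y3 : 'M[R]_n) : 0 < a -> 0 < b ->
  lower_bound a (jacobi a u (jacobi b s Y3)) ->
  lower_bound b (jacobi b s Y3) -> lower_bound (2 / 3 * a) Y3.
Proof.
move=> a0 b0 Ha Hb w uw.
have [al [u2 uE]] := row_mx_split u; rewrite {}uE in Ha.
apply: (@korkine_zolotareff _ b _ al ((intmx w *m u2^T) 0 0) ((intmx w *m s^T) 0 0)) => //.
- move=> x; have := Ha _ (unimodular_row_lift x (unimodular_row_first 0)).
  rewrite intmx_row qf_jacobi /intmx map_row_mx map_mx1 map_mx0 qf_jacobi.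
  rewrite tr_row_mx mul_row_col mul0mx addr0 mul1mx tr_scalar_mx mxE eqxx mulr1n.
  by rewrite mul0mx mxE addr0 qf0 addr0 expr1n mulr1.
- by move=> y; have := Hb _ (unimodular_row_lift y uw); rewrite intmx_row qf_jacobi.
move=> x y; have := Ha _ (unimodular_row_lift x (unimodular_row_lift y uw)).
rewrite intmx_row qf_jacobi intmx_row qf_jacobi tr_row_mx mul_row_col.
by rewrite tr_scalar_mx -scalar_mxM !mxE eqxx mulr1n !addrA.
Qed.

(** The last diagonal entry of [Z] is the reciprocal of the last projected length in the Jacobi
    form. It needs the sharp constant [l], for the descent; the other entries only need some bound
    [C], which makes the reduced [Y] bounded below. *)
Definition reducible n (C l m : R) (Y : 'M[R]_n) : Prop :=
  exists2 U : 'M[int]_n, U \in unitmx &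
  let Z := invmx (intmx U *m Y *m (intmx U)^T) in
  (forall i, Z i i <= C / m) /\ (forall i : 'I_n, i.+1 = n -> Z i i <= l / m).

Lemma reducible_congr n C l m (Y : 'M[R]_n) V : V \in unitmx ->
  reducible C l m (intmx V *m Y *m (intmx V)^T) -> reducible C l m Y.
Proof.
move=> uV [U uU H]; exists (U *m V); first by rewrite unitmx_mul uU.
by rewrite intmxM trmx_mul !mulmxA in H *.
Qed.

Lemma reducible_scale n C l m k (Y : 'M[R]_n) : k != 0 ->
  reducible C l (k * m) Y -> reducible (C / k) (l / k) m Y.
Proof.
move=> k0 [U uU [H1 H2]]; exists U => //.
have E x : x / (k * m) = x / k / m by rewrite invfM mulrA.
by split=> i; rewrite -E//; exact: H2.
Qed.

(** The largest eigenvalue is at most the trace. With [t = tr Z], [sqnorm_le] at [u Z] gives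
    [|u Z|^2 <= t qf Z u], which is inserted into [2 t qf Z u <= t^2 |u|^2 + |u Z|^2]. *)
Lemma qf_le_tr n (Z : 'M[R]_n) u : pos_def Z -> qf Z u <= \tr Z * sqnorm u.
Proof.
case: n Z u => [|n] Z u pZ.
  by rewrite [u]thinmx0 qf0 /sqnorm big_ord0 mulr0.
have t0 : 0 < \tr Z.
  rewrite /mxtrace big_ord_recl ltr_pwDl ?pos_def_diag//.
  by apply: sumr_ge0 => i _; exact/ltW/pos_def_diag.
have := sqnorm_le (u *m Z) (pos_def_inv pZ).
rewrite invmxK -{1}(pos_def_sym pZ) => h.
have qE : qf (invmx Z) (u *m Z) = qf Z u.
  rewrite -qf_congr mulmxV ?pos_def_unit// mul1mx (pos_def_sym pZ) //.
rewrite (pos_def_sym pZ) qE in h.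
have E : qf Z u = \sum_i (u *m Z) 0 i * u 0 i.
  by rewrite /qf [LHS]mxE; apply: eq_bigr => i _; rewrite [u^T _ _]mxE.
have : 2 * \tr Z * qf Z u <= (\tr Z) ^+ 2 * sqnorm u + sqnorm (u *m Z).
  rewrite E /sqnorm; move: (\tr Z) => t; rewrite !mulr_sumr -big_split /=; apply: ler_sum => i _.
  have amgm (x y : R) : 2 * t * (y * x) <= t ^+ 2 * x ^+ 2 + y ^+ 2.
    by have := sqr_ge0 (t * x - y); nra.
  exact: amgm.
move=> h2; rewrite -(ler_pM2l t0); nra.
Qed.

(** By [mulV_jacobi] the new inverse contains the old one as its lower block, so the last entry and
    its constant [l] survive. The new corner is [1 / a + qf Z u'], bounded by size reduction: [K]
    combines [tr Z <= n C / m] with [|u'|^2 <= n / 4]. *)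
Lemma reducible_lift n C l : (0 < n)%N -> exists C', forall a u (Y2 : 'M[R]_n) m,
  0 < m -> m <= a -> pos_def Y2 -> reducible C l m Y2 ->
  reducible C' l m (jacobi a u Y2).
Proof.
move=> n0; pose K := n%:R * C * (n%:R / 4); exists (1 + `|K| + `|C|) => a u Y2 m m0 ma p2.
move=> [V uV [H1 H2]]; have a0 := lt_le_trans m0 ma.
have [U uU [u' Hu' E]] := lift_row a u Y2 uV.
exists U => //; rewrite E; have p3 := pos_def_congr p2 (intmx_unit uV).
rewrite mulV_jacobi ?pos_def_unit ?gt_eqF//.
set Z := invmx _ in H1 H2 *; have pZ : pos_def Z by exact: pos_def_inv.
split=> i.
  case: (split_ordP i) => j ->.
    rewrite block_mxEul ord1 mxE [_%:M _ _]mxE eqxx mulr1n -/(qf _ _).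
    rewrite mulrDl mulrDl div1r -addrA; apply: lerD.
      by rewrite lef_pV2.
    apply: (le_trans (qf_le_tr _ pZ)).
    apply: (@le_trans _ _ (K / m)); last first.
      rewrite -mulrDl ler_pM2r ?invr_gt0//.
      by rewrite (le_trans (ler_norm _))// lerDl.
    have -> : K / m = (n%:R * (C / m)) * (n%:R / 4) by rewrite /K; ring.
    apply: ler_pM.
    - by apply: sumr_ge0 => i' _; exact/ltW/pos_def_diag.
    - exact: sqnorm_ge0.
    - have -> : n%:R * (C / m) = \sum_(i < n) (C / m).
        by rewrite sumr_const card_ord mulr_natl.
      by apply: ler_sum => i' _; exact: H1.
    - have -> : n%:R / 4 = \sum_(i < n) (1 / 4 : R).
        by rewrite sumr_const card_ord -[RHS]mulr_natl mul1r.
      apply: ler_sum => i' _; rewrite -real_normK ?num_real//.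
      by move: (Hu' i') (normr_ge0 (u' 0 i')); nra.
  rewrite block_mxEdr; apply: (le_trans (H1 j)).
  rewrite ler_pM2r ?invr_gt0//; apply: (le_trans (ler_norm _)).
  by rewrite lerDr addr_ge0.
case: (split_ordP i) => j ->.
  by rewrite ord1 /= => h; exfalso; lia.
by rewrite /= add1n => -[h]; rewrite block_mxEdr; apply: H2; lia.
Qed.

Definition reduction n (l : R) : Prop :=
  exists C, forall (Y : 'M[R]_n) m, pos_def Y -> 0 < m -> lower_bound m Y ->
  reducible C l m Y.

Lemma reduction1 : reduction 1 1.
Proof.
exists 1 => Y m pY m0 H; exists 1%:M; first exact: unitmx1.
rewrite /intmx map_mx1 mul1mx trmx1 mulmx1 /=.
suff h (i : 'I_1) : invmx Y i i <= 1 / m by split.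
have d0 := pos_def_diag 0 pY; rewrite ord1.
have -> : invmx Y 0 0 = (Y 0 0)^-1.
  by rewrite [Y]mx11E invmx_scalar !mxE eqxx !mulr1n.
rewrite div1r lef_pV2//.
have := H (row 0 1%:M); rewrite -qf_delta.
have -> : intmx (row 0 1%:M : 'rV[int]_1) = delta_mx 0 0.
  by apply/rowP=> k; rewrite !ord1 !mxE.
by apply; exists 1%:M; rewrite ?unitmx1//; exists 0.
Qed.

Lemma lower_bound_congr_jacobi n a u (Y2 : 'M[R]_n) Y m U : U \in unitmx ->
  intmx U *m Y *m (intmx U)^T = jacobi a u Y2 -> lower_bound m Y -> m <= a.
Proof.
move=> uU E /(lower_bound_congr uU); rewrite E => H.
rewrite -(jacobi_diag0 a u Y2) -qf_delta.
have := H (row 0 1%:M).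
have -> : intmx (row 0 1%:M : 'rV[int]_(1 + n)) = delta_mx 0 0.
  by apply/rowP=> k; rewrite !mxE eq_sym; case: eqP.
by apply; exists 1%:M; rewrite ?unitmx1//; exists 0.
Qed.

Lemma reduction_hermite n l : (0 < n)%N ->
  reduction n l -> reduction (1 + n) (4 / 3 * l).
Proof.
move=> n0 [C HC]; have [C' HC'] := reducible_lift (C / (3 / 4)) (l / (3 / 4)) n0.
exists C' => Y m pY m0 H.
have [U uU [a [u [Y2 [a0 p2 E Ha]]]]] := first_min pY.
have ma := lower_bound_congr_jacobi uU E H.
apply: (reducible_congr uU); rewrite E.
have -> : 4 / 3 * l = l / (3 / 4) by field.
apply: HC' => //; apply: reducible_scale; first by lra.
apply: HC => //; first by rewrite mulr_gt0//; lra.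
by apply: lower_bound_le (lower_bound_tail a0 Ha); lra.
Qed.

(** Two dimensions cost 3/2 here, against 16/9 for two Hermite steps; this saving brings the
    constant in dimension five below pi. *)
Lemma reduction_korkine_zolotareff n l : (0 < n)%N ->
  reduction n l -> reduction (1 + (1 + n)) (3 / 2 * l).
Proof.
move=> n0 [C HC]; have [C1 HC1] := reducible_lift C l n0.
have [C2 HC2] := reducible_lift C1 l (ltn0Sn n).
exists (C2 / (2 / 3)) => Y m pY m0 H.
have [U uU [a [u [Y2 [a0 p2 E Ha]]]]] := first_min pY.
have ma := lower_bound_congr_jacobi uU E H.
apply: (reducible_congr uU); rewrite E.
have [V uV [b [s [Y3 [b0 p3 E2 Hb]]]]] := first_min p2.
have [W uW [u' _ E3]] := lift_row a u Y2 uV.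
apply: (reducible_congr uW); rewrite E3 E2.
have Ha' := lower_bound_congr uW Ha; rewrite E3 E2 in Ha'.
have ab := lower_bound_congr_jacobi uV E2 (lower_bound_tail a0 Ha).
have H3 := lower_bound_tail2 a0 b0 Ha' Hb.
have -> : 3 / 2 * l = l / (2 / 3) by field.
apply: reducible_scale; first by lra.
have m1 : 0 < 2 / 3 * m by rewrite mulr_gt0//; lra.
apply: HC2 => //; first by lra.
  by rewrite -E2; apply: pos_def_congr => //; exact: intmx_unit.
apply: HC1 => //; first by lra.
apply: HC => //; apply: lower_bound_le H3; lra.
Qed.

Lemma reduction_exists n : exists l, reduction n.+1 l.
Proof.
elim: n => [|n [l Hl]]; first by exists 1; exact: reduction1.
by exists (4 / 3 * l); exact: reduction_hermite.
Qed.

(** Dimensions two and three are reached from one by a Hermite step and by a Korkine-Zolotareff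
    step; a further Korkine-Zolotareff step reaches four and five. *)
Lemma reduction_small n : (n < 5)%N ->
  exists2 l, l <= 9 / 4 & reduction n.+1 l.
Proof.
have r2 := reduction_hermite (ltn0Sn 0) reduction1.
have r3 := reduction_korkine_zolotareff (ltn0Sn 0) reduction1.
have r4 := reduction_korkine_zolotareff (ltn0Sn 1) r2.
have r5 := reduction_korkine_zolotareff (ltn0Sn 2) r3.
case: n => [|[|[|[|[|//]]]]] _.
- by exists 1; [lra | exact: reduction1].
- by eexists; last exact: r2; lra.
- by eexists; last exact: r3; lra.
- by eexists; last exact: r4; lra.
- by eexists; last exact: r5; lra.
Qed.

End Reduction.

(** * The action of the symplectic group *)

Section Symplectic.
Variables (R : realType) (g : nat).
Local Notation C := R[i].
Local Notation Im := (@complex.Im R).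
Local Notation Re := (@complex.Re R).
Local Notation normc := (@ComplexField.Normc.normc R).
Implicit Types (M N : 'M[int]_(g + g)) (tau : 'M[C]_g).

Definition cmx m n (X : 'M[R]_(m, n)) : 'M[C]_(m, n) := map_mx (real_complex R) X.
Definition immx m n (X : 'M[C]_(m, n)) : 'M[R]_(m, n) := map_mx Im X.
Definition remx m n (X : 'M[C]_(m, n)) : 'M[R]_(m, n) := map_mx Re X.
Definition cjmx m n (X : 'M[C]_(m, n)) : 'M[C]_(m, n) := map_mx (@conjc R) X.

Lemma cmxM m n p (X : 'M[R]_(m, n)) (Y : 'M[R]_(n, p)) :
  cmx (X *m Y) = cmx X *m cmx Y.
Proof. exact: map_mxM. Qed.

Lemma cjmxM m n p (X : 'M[C]_(m, n)) (Y : 'M[C]_(n, p)) :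
  cjmx (X *m Y) = cjmx X *m cjmx Y.
Proof. exact: map_mxM. Qed.

Lemma cmx_tr m n (X : 'M[R]_(m, n)) : cmx X^T = (cmx X)^T.
Proof. by rewrite /cmx map_trmx. Qed.

Lemma cmx_inj m n : injective (@cmx m n).
Proof. by move=> X Y /matrixP H; apply/matrixP=> i j; have := H i j; rewrite !mxE => -[]. Qed.

Lemma cjmx_cmx m n (X : 'M[R]_(m, n)) : cjmx (cmx X) = cmx X.
Proof. by apply/matrixP=> i j; rewrite !mxE conjc_real. Qed.

Lemma cjmx_intC m n (X : 'M[int]_(m, n)) : cjmx (intC R X) = intC R X.
Proof. by apply/matrixP=> i j; rewrite !mxE rmorph_int. Qed.

Lemma intC_cmx m n (X : 'M[int]_(m, n)) : intC R X = cmx (intmx R X).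
Proof. by apply/matrixP=> i j; rewrite !mxE rmorph_int. Qed.

Lemma mxC_split m n (X : 'M[C]_(m, n)) : X = cmx (remx X) + 'i *: cmx (immx X).
Proof. by apply/matrixP=> i j; rewrite !mxE -complexE. Qed.

Lemma cjmx_split m n (X : 'M[C]_(m, n)) :
  cjmx X = cmx (remx X) - 'i *: cmx (immx X).
Proof.
apply/matrixP=> i j; rewrite !mxE; case: (X i j) => a b /=.
by simpc.
Qed.

Lemma cjmx_sub m n (X : 'M[C]_(m, n)) :
  cjmx X - X = (- 2 * 'i) *: cmx (immx X).
Proof.
rewrite {2}[X]mxC_split cjmx_split opprD addrACA subrr add0r -!scaleNr -scalerDl.
by congr (_ *: _); rewrite mulNr mulr2n mulrDl mul1r opprD.
Qed.

Lemma norm_normc (z : C) : `|z| = (normc z)%:C.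
Proof. by rewrite normc_def; case: z. Qed.

Definition hnorm n (Y : 'M[R]_n) (v : 'rV[C]_n) : R :=
  qf Y (remx v) + qf Y (immx v).

Lemma hermitian_form n (Y : 'M[R]_n) (v : 'rV[C]_n) : Y^T = Y ->
  v *m cmx Y *m (cjmx v)^T = (hnorm Y v)%:C%:M.
Proof.
move=> sY; rewrite {1}[v]mxC_split cjmx_split linearB linearZ /=.
have E : cmx (immx v) *m cmx Y *m (cmx (remx v))^T
   = cmx (remx v) *m cmx Y *m (cmx (immx v))^T.
  rewrite -!cmx_tr -!cmxM; congr cmx.
  have -> : immx v *m Y *m (remx v)^T = (remx v *m Y *m (immx v)^T)^T.
    by rewrite !trmx_mul trmxK sY mulmxA.
  by apply/matrixP=> i j; rewrite mxE !ord1.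
rewrite !mulmxDl !mulmxBr -!scalemxAl -!scalemxAr E !scalerA.
have -> : 'i * 'i = -1 :> C by rewrite -expr2 sqr_i.
rewrite scaleN1r opprK addrA subrK.
apply/matrixP=> i j; rewrite !ord1 /hnorm /qf rmorphD /cmx /= !map_trmx -!map_mxM.
by rewrite [LHS]mxE [in LHS]mxE [X in _ + X]mxE [in RHS]mxE eqxx mulr1n.
Qed.

Lemma hnorm_gt0 n (Y : 'M[R]_n) v : pos_def Y -> v != 0 -> 0 < hnorm Y v.
Proof.
move=> pY v0; have h1 := pos_def_ge0 (remx v) pY.
have h2 := pos_def_ge0 (immx v) pY.
have [r0|r0] := eqVneq (remx v) 0; last exact: ltr_pwDl (pos_def_gt0 pY r0) h2.
have [i0|i0] := eqVneq (immx v) 0; last exact: ltr_wpDl h1 (pos_def_gt0 pY i0).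
by case/eqP: v0; rewrite [v]mxC_split r0 i0 /cmx !map_mx0 scaler0 addr0.
Qed.

Lemma cjmxK m n : involutive (@cjmx m n).
Proof. by move=> X; apply/matrixP=> i j; rewrite !mxE conjcK. Qed.

Lemma cjmx_tr m n (X : 'M[C]_(m, n)) : cjmx X^T = (cjmx X)^T.
Proof. by rewrite /cjmx map_trmx. Qed.

Definition colmx tau : 'M[C]_(g + g, g) := col_mx tau 1%:M.
Definition numerator_mx M tau := intC R (ulsubmx M) *m tau + intC R (ursubmx M).

Lemma siegel_actE M tau :
  siegel_act M tau = numerator_mx M tau *m invmx (automorphy_mx M tau).
Proof. by []. Qed.

Lemma mul_colmx M tau :
  intC R M *m colmx tau = col_mx (numerator_mx M tau) (automorphy_mx M tau).
Proof.
rewrite -[M in LHS]submxK /intC map_block_mx /colmx mul_block_col !mulmx1.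
by [].
Qed.

Definition formC : 'M[C]_(g + g) := intC R (symplectic_form g).

Lemma formC_col m n (A B : 'M[C]_(g, m)) (P Q : 'M[C]_(g, n)) :
  (col_mx A B)^T *m formC *m col_mx P Q = A^T *m Q - B^T *m P.
Proof.
rewrite /formC /intC /symplectic_form map_block_mx tr_col_mx mul_row_block mul_row_col.
rewrite !map_mx0 !mulmx0 add0r addr0 map_mxN map_mx1 mulmxN !mulmx1.
by rewrite mulNmx addrC.
Qed.

Lemma Sp_formC M : Sp M -> (intC R M)^T *m formC *m intC R M = formC.
Proof.
by move=> sM; rewrite /formC -{2}sM /intC !map_mxM map_trmx.
Qed.

Section Action.
Variables (M : 'M[int]_(g + g)) (tau : 'M[C]_g).
Hypothesis sM : Sp M.
Let P := numerator_mx M tau.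
Let Q := automorphy_mx M tau.

(** [M] preserves the symplectic pairing of the columns [(s; 1)] and [(tau; 1)]. Taking [s = tau]
    gives the symmetry of [M tau], and [s] the conjugate of [tau] gives the formula for its
    imaginary part. *)
Lemma act_form (s : 'M[C]_g) :
  (numerator_mx M s)^T *m Q - (automorphy_mx M s)^T *m P = s^T - tau.
Proof.
rewrite -formC_col -!mul_colmx trmx_mul.
rewrite -!mulmxA [formC *m _]mulmxA [(intC R M)^T *m _]mulmxA.
rewrite [(intC R M)^T *m _]mulmxA Sp_formC// mulmxA /colmx formC_col.
by rewrite trmx1 mulmx1 mul1mx.
Qed.

Lemma numerator_conj s : numerator_mx M (cjmx s) = cjmx (numerator_mx M s).
Proof. by rewrite /numerator_mx /cjmx map_mxD -!/(cjmx _) cjmxM !cjmx_intC. Qed.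

Lemma automorphy_conj s : automorphy_mx M (cjmx s) = cjmx (automorphy_mx M s).
Proof. by rewrite /automorphy_mx /cjmx map_mxD -!/(cjmx _) cjmxM !cjmx_intC. Qed.

Hypothesis hT : siegel_half_space tau.
Let tauT : tau^T = tau. Proof. by case: hT. Qed.
Let pY : pos_def (immx tau). Proof. by case: hT. Qed.

(** For [s] the conjugate of [tau], a vector in the kernel of [Q] kills the left side of [act_form],
    hence is isotropic for the definite Hermitian form of [Im tau]. *)
Lemma automorphy_unit : Q \in unitmx.
Proof.
rewrite -unitmx_tr -row_free_unit; apply: inj_row_free => v vQ.
have Qv : Q *m v^T = 0 by apply: trmx_inj; rewrite trmx_mul trmxK vQ trmx0.
have := act_form (cjmx tau); rewrite numerator_conj automorphy_conj -/P -/Q.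
rewrite [X in _ = X - _](_ : _ = cjmx tau); last by rewrite /cjmx map_trmx tauT.
move=> /(congr1 (fun X => cjmx v *m X *m v^T)).
have vQ2 : cjmx v *m (cjmx Q)^T = 0.
  by rewrite /cjmx map_trmx -map_mxM vQ map_mx0.
rewrite mulmxBr mulmxBl -!mulmxA Qv !mulmx0 [cjmx v *m ((cjmx Q)^T *m _)]mulmxA vQ2.
rewrite mul0mx subr0 cjmx_sub mulmxA -scalemxAr -scalemxAl => /esym/eqP.
rewrite scaler_eq0.
have -> /= : (- 2 * 'i == 0 :> C) = false.
  by rewrite mulf_eq0 oppr_eq0 pnatr_eq0 /= eq_complex /= oner_eq0 andbF.
have := hermitian_form (cjmx v) (pos_def_sym pY); rewrite cjmxK => ->.
move=> /eqP /matrixP/(_ 0 0); rewrite !mxE eqxx mulr1n => -[h].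
have [/(congr1 (@cjmx _ _))|v0] := eqVneq (cjmx v) 0.
  by rewrite cjmxK /cjmx map_mx0.
by have := hnorm_gt0 pY v0; rewrite h ltxx.
Qed.

Let sigma := siegel_act M tau.

Lemma numeratorE : P = sigma *m Q.
Proof. by rewrite /sigma siegel_actE mulmxKV// automorphy_unit. Qed.

Lemma siegel_act_tr : sigma^T = sigma.
Proof.
have uQ := automorphy_unit.
have := act_form tau; rewrite -/P -/Q tauT subrr => /eqP.
rewrite subr_eq0 numeratorE trmx_mul => /eqP h.
have uQT : Q^T \in unitmx by rewrite unitmx_tr.
move: h; rewrite -mulmxA => /(congr1 (mulmx (invmx Q^T))); rewrite !mulKmx//.
by move=> /(congr1 (mulmx^~ (invmx Q))); rewrite /= !mulmxK.
Qed.

Lemma immx_act : cmx (immx tau) = (cjmx Q)^T *m cmx (immx sigma) *m Q.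
Proof.
have := act_form (cjmx tau); rewrite numerator_conj automorphy_conj -/P -/Q.
rewrite [X in _ = X - _](_ : _ = cjmx tau); last by rewrite /cjmx map_trmx tauT.
rewrite cjmx_sub numeratorE cjmxM trmx_mul.
rewrite [(cjmx sigma)^T](_ : _ = cjmx sigma); last by rewrite /cjmx map_trmx siegel_act_tr.
rewrite [_ *m (sigma *m Q)]mulmxA -mulmxBl -mulmxBr cjmx_sub.
rewrite -scalemxAr -scalemxAl => /scalerI h; apply/esym/h.
by rewrite mulf_eq0 oppr_eq0 pnatr_eq0 /= eq_complex /= oner_eq0 andbF.
Qed.

Lemma immx_act_form v :
  qf (immx sigma) v = hnorm (immx tau) (cmx v *m invmx (cjmx Q)^T).
Proof.
set w := cmx v *m _; have uQ := automorphy_unit.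
have ucQ : (cjmx Q)^T \in unitmx by rewrite unitmx_tr /cjmx map_unitmx.
have := hermitian_form w (pos_def_sym pY); rewrite immx_act.
have -> : cjmx w = cmx v *m invmx Q^T.
  by rewrite /w cjmxM cjmx_cmx {1}/cjmx map_invmx -/(cjmx _) cjmx_tr cjmxK.
rewrite trmx_mul trmx_inv trmxK !mulmxA mulmxKV// mulmxK//.
move/matrixP/(_ 0 0); rewrite [RHS]mxE eqxx mulr1n /cmx map_trmx -!map_mxM mxE => -[] //.
Qed.

Lemma siegel_act_half_space : siegel_half_space sigma.
Proof.
split; first exact: siegel_act_tr.
split; first by rewrite map_trmx siegel_act_tr.
move=> v v0; rewrite -/(qf _ _) -/(immx _) immx_act_form; apply: hnorm_gt0 => //.
have ucQ : (cjmx Q)^T \in unitmx.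
  by rewrite unitmx_tr /cjmx map_unitmx automorphy_unit.
apply: contra_neq v0 => w0; apply: cmx_inj; rewrite [in RHS]/cmx map_mx0.
by rewrite -[LHS](mulmxKV ucQ) w0 mul0mx.
Qed.

Lemma det_immx_act :
  \det (immx tau) = normc (\det Q) ^+ 2 * \det (immx sigma).
Proof.
have := congr1 determinant immx_act; rewrite !det_mulmx det_tr !det_map_mx.
rewrite mulrAC -/(cjmx Q).
have -> : (\det Q)^*%C * \det Q = (normc (\det Q) ^+ 2)%:C.
  by rewrite mulrC -sqr_normc rmorphXn /= norm_normc.
by rewrite -rmorphM => -[].
Qed.

(** Passing to the inverse of the imaginary part replaces [Q^-1] by [Q = C tau + D], which is linear
    in the integral matrices [C] and [D]. *)
Lemma inv_immx_act_form (x : 'rV[R]_g) :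
  qf (invmx (immx sigma)) x = hnorm (invmx (immx tau)) (cmx x *m Q).
Proof.
set w := cmx x *m Q; have uQ := automorphy_unit.
have pS : pos_def (immx sigma) by case: siegel_act_half_space.
have ucQ : (cjmx Q)^T \in unitmx by rewrite unitmx_tr /cjmx map_unitmx.
have := hermitian_form w (pos_def_sym (pos_def_inv pY)).
have -> : cmx (invmx (immx tau)) =
    invmx Q *m cmx (invmx (immx sigma)) *m invmx (cjmx Q)^T.
  have uS : cmx (immx sigma) \in unitmx by rewrite /cmx map_unitmx pos_def_unit.
  have uT : cmx (immx tau) \in unitmx by rewrite /cmx map_unitmx pos_def_unit.
  rewrite {1 2}/cmx !map_invmx -!/(cmx _) -[RHS]mul1mx -(mulVmx uT) {3}immx_act.
  rewrite -!mulmxA [Q *m (_ *m _)]mulmxA mulmxV// mul1mx.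
  by rewrite [cmx _ *m (invmx _ *m _)]mulmxA mulmxV// mul1mx mulmxV// mulmx1.
rewrite /w cjmxM cjmx_cmx trmx_mul !mulmxA mulmxK// mulmxKV//.
move/matrixP/(_ 0 0); rewrite [RHS]mxE eqxx mulr1n /cmx map_trmx -!map_mxM mxE => -[] //.
Qed.

End Action.

(** * Group structure and the cocycle relation *)

Lemma Sp1 : Sp (1%:M : 'M[int]_(g + g)).
Proof. by rewrite /Sp /= trmx1 mul1mx mulmx1. Qed.

Lemma SpM M N : Sp M -> Sp N -> Sp (M *m N).
Proof.
rewrite /Sp /= => sM sN; rewrite trmx_mul -!mulmxA [_ *m (M *m N)]mulmxA.
by rewrite [M^T *m _]mulmxA [M^T *m _]mulmxA sM mulmxA.
Qed.

Lemma form_sq : symplectic_form g *m symplectic_form g = - 1%:M.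
Proof.
rewrite /symplectic_form mulmx_block !mul0mx !mulmx0 !mul1mx !mulmx1 !addr0 !add0r.
by rewrite (scalar_mx_block g g 1) opp_block_mx !oppr0.
Qed.

Definition sp_inv M := - (symplectic_form g *m M^T *m symplectic_form g).

Lemma sp_invM M : Sp M -> sp_inv M *m M = 1%:M.
Proof.
move=> sM; rewrite /sp_inv mulNmx -!mulmxA [M^T *m _]mulmxA sM.
by rewrite form_sq opprK.
Qed.

Lemma sp_Minv M : Sp M -> M *m sp_inv M = 1%:M.
Proof. by move=> /sp_invM; exact: mulmx1C. Qed.

Lemma Sp_inv M : Sp M -> Sp (sp_inv M).
Proof.
move=> sM; have e := sp_Minv sM.
rewrite /Sp /= -{1}sM -!mulmxA e mulmx1 mulmxA -trmx_mul e trmx1 mul1mx //.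
Qed.

Lemma automorphyM M N tau : Sp M -> Sp N -> siegel_half_space tau ->
  automorphy_mx (M *m N) tau = automorphy_mx M (siegel_act N tau) *m automorphy_mx N tau
  /\ numerator_mx (M *m N) tau = numerator_mx M (siegel_act N tau) *m automorphy_mx N tau.
Proof.
move=> sM sN hT; have := mul_colmx (M *m N) tau.
rewrite /intC map_mxM -!/(intC _ _) -mulmxA mul_colmx (numeratorE sN hT).
have -> : col_mx (siegel_act N tau *m automorphy_mx N tau) (automorphy_mx N tau)
   = colmx (siegel_act N tau) *m automorphy_mx N tau.
  by rewrite /colmx mul_col_mx mul1mx.
by rewrite mulmxA mul_colmx mul_col_mx => /eq_col_mx[-> ->].
Qed.

Lemma siegel_actM M N tau : Sp M -> Sp N -> siegel_half_space tau ->
  siegel_act (M *m N) tau = siegel_act M (siegel_act N tau).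
Proof.
move=> sM sN hT; have [e1 e2] := automorphyM sM sN hT.
have hN := siegel_act_half_space sN hT.
rewrite siegel_actE e1 e2.
have u1 := automorphy_unit sN hT; have u2 := automorphy_unit sM hN.
rewrite [siegel_act M _]siegel_actE; apply: (canLR (mulmxK _)); first by rewrite unitmx_mul u1 u2.
by rewrite mulmxA mulmxKV.
Qed.

Lemma slashM k f M N tau : Sp M -> Sp N -> siegel_half_space tau ->
  slash k f (M *m N) tau =
  \det (automorphy_mx N tau) ^- k * slash k f M (siegel_act N tau).
Proof.
move=> sM sN hT; rewrite /slash siegel_actM//.
have [-> _] := automorphyM sM sN hT.
by rewrite det_mulmx exprMn invfM [X in X * _ = _]mulrC mulrA.
Qed.

End Symplectic.

(** * Reduction in the Siegel half space *)

Section SiegelReduction.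
Variables (R : realType) (g : nat).
Local Notation C := R[i].
Local Notation normc := (@ComplexField.Normc.normc R).
Implicit Types (M N : 'M[int]_(g + g)) (tau : 'M[C]_g).

Lemma Sp_block (A B C D : 'M[int]_g) : A^T *m C = C^T *m A ->
  B^T *m D = D^T *m B -> A^T *m D - C^T *m B = 1%:M -> Sp (block_mx A B C D).
Proof.
move=> h1 h2 h3; rewrite /Sp /= /symplectic_form tr_block_mx !mulmx_block.
rewrite !mulmx0 !mulmx1 !mulmxN !mulmx1 !addr0 !add0r !mulNmx.
congr block_mx.
- by rewrite h1 addNr.
- by rewrite addrC.
- have := congr1 trmx h3; rewrite linearB /= !trmx_mul !trmxK trmx1 => <-.
  by rewrite opprB addrC.
- by rewrite h2 addNr.
Qed.

(** * Translations, unimodular substitutions and partial inversions *)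

Definition translation_mx (S : 'M[int]_g) : 'M[int]_(g + g) := block_mx 1%:M S 0 1%:M.
Definition levi_mx (U : 'M[int]_g) : 'M[int]_(g + g) :=
  block_mx U 0 0 (invmx U)^T.
(** The matrix [(0, -1; 1, 0)] of SL(2, Z) in the j-th hyperbolic plane, and the identity on the
    others. *)
Definition inversion_mx (j : 'I_g) : 'M[int]_(g + g) :=
  let e := delta_mx j j in block_mx (1%:M - e) (- e) e (1%:M - e).

Lemma Sp_translation S : S^T = S -> Sp (translation_mx S).
Proof.
move=> sS; apply: Sp_block; rewrite ?trmx0 ?trmx1 ?mulmx0 ?mul0mx ?mul1mx ?mulmx1 ?subr0//.
Qed.

Lemma Sp_levi U : U \in unitmx -> Sp (levi_mx U).
Proof.
move=> uU; apply: Sp_block; rewrite ?trmx0 ?mulmx0 ?mul0mx ?subr0//.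
by rewrite -trmx_mul mulVmx// trmx1.
Qed.

Lemma Sp_inversion j : Sp (inversion_mx j).
Proof.
have ee : delta_mx j j *m delta_mx j j = delta_mx j j :> 'M[int]_g.
  by rewrite mul_delta_mx.
have et : (delta_mx j j : 'M[int]_g)^T = delta_mx j j by rewrite trmx_delta.
have ft : (1%:M - delta_mx j j : 'M[int]_g)^T = 1%:M - delta_mx j j.
  by rewrite linearB /= trmx1 et.
apply: Sp_block; rewrite ?ft ?[(- _)^T]linearN /= ?et.
- by rewrite mulmxBl mulmxBr mul1mx mulmx1.
- by rewrite mulNmx mulmxN mulmxBr mulmxBl mul1mx mulmx1.
- by rewrite mulmxN ee opprK mulmxBl mul1mx mulmxBr mulmx1 ee subrr subr0 subrK.
Qed.

Lemma intC0 m n : intC R (0 : 'M[int]_(m, n)) = 0.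
Proof. exact: map_mx0. Qed.

Lemma intC1 n : intC R (1%:M : 'M[int]_n) = 1%:M.
Proof. exact: map_mx1. Qed.

Lemma automorphy_block (A B C D : 'M[int]_g) tau :
  automorphy_mx (block_mx A B C D) tau = intC R C *m tau + intC R D.
Proof. by rewrite /automorphy_mx block_mxKdl block_mxKdr. Qed.

Lemma numerator_block (A B C D : 'M[int]_g) tau :
  numerator_mx (block_mx A B C D) tau = intC R A *m tau + intC R B.
Proof. by rewrite /numerator_mx block_mxKul block_mxKur. Qed.

Lemma automorphy_translation S tau : automorphy_mx (translation_mx S) tau = 1%:M.
Proof. by rewrite automorphy_block intC0 intC1 mul0mx add0r. Qed.

Lemma act_translation S tau : siegel_act (translation_mx S) tau = tau + intC R S.
Proof.
rewrite siegel_actE automorphy_translation numerator_block intC1 mul1mx.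
by rewrite invmx1 mulmx1.
Qed.

Lemma intC_tr m n (X : 'M[int]_(m, n)) : intC R X^T = (intC R X)^T.
Proof. by rewrite /intC map_trmx. Qed.

Lemma intC_unit n (U : 'M[int]_n) : U \in unitmx -> intC R U \in unitmx.
Proof.
move=> uU; apply: (@proj1 _ _ (mulmx1_unit (B := intC R (invmx U)) _)).
by rewrite /intC -map_mxM mulmxV// map_mx1.
Qed.

Lemma automorphy_levi U tau : automorphy_mx (levi_mx U) tau = intC R (invmx U)^T.
Proof. by rewrite automorphy_block intC0 mul0mx add0r. Qed.

Lemma act_levi U tau : U \in unitmx ->
  siegel_act (levi_mx U) tau = intC R U *m tau *m (intC R U)^T.
Proof.
move=> uU; rewrite siegel_actE automorphy_levi numerator_block intC0 addr0.
congr (_ *m _); rewrite -[LHS]mul1mx.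
have -> : 1%:M = (intC R U)^T *m intC R (invmx U)^T.
  by rewrite -intC_tr /intC -map_mxM -trmx_mul mulVmx// trmx1 map_mx1.
by rewrite mulmxK// intC_unit// unitmx_tr unitmx_inv.
Qed.

Lemma det_int_unit n (U : 'M[int]_n) : U \in unitmx -> (\det U) ^+ 2 = 1.
Proof. by rewrite unitmxE => /orP[] /eqP ->. Qed.

Lemma det_automorphy_levi U tau : U \in unitmx ->
  \det (automorphy_mx (levi_mx U) tau) ^+ 2 = 1.
Proof.
move=> uU; rewrite automorphy_levi /intC det_map_mx det_tr -rmorphXn /=.
by rewrite det_int_unit ?unitmx_inv// rmorph1.
Qed.

(** The automorphy matrix is the identity with its j-th row replaced by that of [tau]. *)
Lemma det_inversion (tau : 'M[C]_g) j :
  \det (automorphy_mx (inversion_mx j) tau) = tau j j.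
Proof.
rewrite /inversion_mx automorphy_block; set Q := _ + _.
have QE i k : Q i k = (if i == j then tau j k else (i == k)%:R).
  rewrite !mxE (bigD1 j)//= big1 => [|l lj]; last first.
    by rewrite !mxE (negbTE lj) andbF mul0r.
  rewrite !mxE eqxx andbT addr0; have [->|ij] := eqVneq i j.
    by rewrite /= mul1r [k == j]eq_sym subrr addr0.
  by rewrite /= mul0r add0r subr0 rmorph_nat.
have cE k : cofactor Q j k = cofactor 1%:M j k.
  rewrite /cofactor; congr (_ * \det _); apply/matrixP=> x y.
  rewrite mxE [RHS]mxE mxE [RHS]mxE QE [_ == j]eq_sym (negbTE (neq_lift j x)).
  by rewrite mxE.
have adj1 : \adj (1%:M : 'M[C]_g) = 1%:M.
  by rewrite -[LHS]mul1mx mul_mx_adj det1.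
rewrite (expand_det_row _ j) (bigD1 j)//= big1 => [|k kj].
  rewrite QE eqxx cE addr0; have := congr1 (fun X : 'M[C]_g => X j j) adj1.
  by rewrite mxE [RHS]mxE eqxx => ->; rewrite mulr1.
rewrite cE; have := congr1 (fun X : 'M[C]_g => X k j) adj1.
by rewrite mxE [RHS]mxE (negbTE kj) => ->; rewrite mulr0.
Qed.

(** * Nearly maximal determinants in an orbit *)

Lemma sqnorm_row_mx m n (c : 'rV[R]_m) (d : 'rV[R]_n) :
  sqnorm (row_mx c d) = sqnorm c + sqnorm d.
Proof.
rewrite /sqnorm big_split_ord /=; congr (_ + _); apply: eq_bigr => i _.
  by rewrite row_mxEl.
by rewrite row_mxEr.
Qed.

Lemma pos_def_block m n (A : 'M[R]_m) (B : 'M[R]_n) :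
  pos_def A -> pos_def B -> pos_def (block_mx A 0 0 B).
Proof.
move=> pA pB; split; first by rewrite tr_block_mx !trmx0 !pos_def_sym.
move=> v; rewrite -[v]hsubmxK; move: (lsubmx v) (rsubmx v) => c d v0.
have -> : (row_mx c d *m block_mx A 0 0 B *m (row_mx c d)^T) 0 0 = qf A c + qf B d.
  by rewrite mul_row_block tr_row_mx mul_row_col !mulmx0 addr0 add0r mxE.
have h1 := pos_def_ge0 c pA; have h2 := pos_def_ge0 d pB.
have [c0|c0] := eqVneq c 0; last exact: ltr_pwDl (pos_def_gt0 pA c0) h2.
have [d0|d0] := eqVneq d 0; last exact: ltr_wpDl h1 (pos_def_gt0 pB d0).
by case/eqP: v0; rewrite c0 d0 row_mx0.
Qed.

Lemma remx_cmx m n (A B : 'M[R]_(m, n)) : remx (cmx A + 'i *: cmx B) = A.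
Proof. by apply/matrixP=> i j; rewrite !mxE; simpc. Qed.

Lemma immx_cmx m n (A B : 'M[R]_(m, n)) : immx (cmx A + 'i *: cmx B) = B.
Proof. by apply/matrixP=> i j; rewrite !mxE; simpc. Qed.

(** With [c = x C] and [d = x D], the right side is [Y(c) + Y^-1(c X + d)], a positive definite form
    in [(c, d)] that does not depend on [M]; [w] bounds it from below. *)
Lemma hnorm_automorphy_ge (tau : 'M[C]_g) : siegel_half_space tau ->
  exists2 w : R, 0 < w & forall M (x : 'rV[R]_g),
    w * (sqnorm (x *m intmx R (dlsubmx M)) + sqnorm (x *m intmx R (drsubmx M)))
    <= hnorm (invmx (immx tau)) (cmx x *m automorphy_mx M tau).
Proof.
move=> [_]; rewrite -/(immx tau); set Y := immx tau => pY; set X := remx tau.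
have pI := pos_def_inv pY.
pose V : 'M[R]_(g + g) := block_mx 1%:M X 0 1%:M.
have uV : V \in unitmx by rewrite unitmxE det_ublock !det1 mulr1 unitr1.
have pW := pos_def_congr (pos_def_block pY pI) uV.
set W := _ *m _ *m _ in pW.
have t0 : 0 < `|\tr (invmx W)| + 1 by rewrite ltr_wpDl.
exists (`|\tr (invmx W)| + 1)^-1; first by rewrite invr_gt0.
move=> M x; set c := x *m _; set d := x *m _.
have -> : hnorm (invmx Y) (cmx x *m automorphy_mx M tau) = qf W (row_mx c d).
  have -> : cmx x *m automorphy_mx M tau = cmx (c *m X + d) + 'i *: cmx (c *m Y).
    rewrite /automorphy_mx mulmxDr mulmxA !intC_cmx -!cmxM -/c -/d [tau]mxC_split.
    by rewrite mulmxDr -scalemxAr -!cmxM -/X -/Y addrAC /cmx map_mxD.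
  rewrite /W qf_congr mul_row_block !mulmx1 mulmx0 addr0.
  rewrite [RHS]/qf mul_row_block tr_row_mx mul_row_col !mulmx0 addr0 add0r [RHS]mxE -!/(qf _ _).
  rewrite /hnorm remx_cmx immx_cmx addrC; congr (_ + _).
  by rewrite -qf_congr mulmxV ?pos_def_unit// mul1mx (pos_def_sym pY).
rewrite mulrC ler_pdivrMr// -sqnorm_row_mx.
apply: le_trans (sqnorm_le _ pW) _; rewrite ler_wpM2l ?pos_def_ge0//.
by rewrite (le_trans (ler_norm _))// lerDl.
Qed.

Lemma intmx_sp_row_eq0 M (x : 'rV[R]_g) : Sp M ->
  x *m intmx R (dlsubmx M) = 0 -> x *m intmx R (drsubmx M) = 0 -> x = 0.
Proof.
move=> sM h1 h2; pose v : 'rV[R]_(g + g) := row_mx 0 x.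
have : v *m intmx R M = 0.
  rewrite -[M]submxK /intmx map_block_mx mul_row_block !mul0mx !add0r.
  by rewrite -!/(intmx _ _) h1 h2 row_mx0.
move=> /(congr1 (mulmx^~ (intmx R (sp_inv M)))).
rewrite /= -mulmxA -intmxM sp_Minv// mul0mx /intmx map_mx1 mulmx1 => hv.
by have := row_mxKr (0 : 'rV[R]_g) x; rewrite -/v hv => <-; apply/matrixP=> i j; rewrite !mxE.
Qed.

(** [Z = C C^T + D D^T] is integral and positive definite, so [det Z >= 1], while
    [Im(M tau)^-1 >= w Z]. Hence [tr(Z S) <= g / w], and this bounds [det Z det S], therefore
    [det S]. *)
Lemma det_immx_act_bounded (tau : 'M[C]_g) : siegel_half_space tau ->
  exists K, forall M, Sp M -> \det (immx (siegel_act M tau)) <= K.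
Proof.
move=> hT; have [w w0 Hw] := hnorm_automorphy_ge hT.
exists ((g%:R / w) ^+ g) => M sM.
set S := immx _; have [_ pS] : siegel_half_space (siegel_act M tau).
  exact: siegel_act_half_space.
rewrite -/(immx _) -/S in pS.
pose Z0 := dlsubmx M *m (dlsubmx M)^T + drsubmx M *m (drsubmx M)^T.
pose Z := intmx R Z0.
have ZE x : qf Z x = sqnorm (x *m intmx R (dlsubmx M)) + sqnorm (x *m intmx R (drsubmx M)).
  have -> : Z = intmx R (dlsubmx M) *m (intmx R (dlsubmx M))^T
               + intmx R (drsubmx M) *m (intmx R (drsubmx M))^T.
    by rewrite -!intmx_tr -!intmxM /Z /Z0 /intmx map_mxD.
  by rewrite -!(qf1 (x *m _)) -!qf_congr !mulmx1 /qf mulmxDr mulmxDl mxE.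
have pZ : pos_def Z.
  split.
    by rewrite -intmx_tr; congr (intmx R _); rewrite linearD /= !trmx_mul !trmxK.
  move=> x x0; rewrite -/(qf _ _) ZE.
  set c := x *m _; set d := x *m _.
  have h1 := sqnorm_ge0 c; have h2 := sqnorm_ge0 d.
  have [c0|c0] := eqVneq c 0; last exact: ltr_pwDl (sqnorm_gt0 c0) h2.
  have [d0|d0] := eqVneq d 0; last exact: ltr_wpDl h1 (sqnorm_gt0 d0).
  by case/eqP: x0; exact: intmx_sp_row_eq0 sM c0 d0.
have Z1 : 1 <= \det Z.
  have := pos_def_det pZ; rewrite /Z /intmx det_map_mx ltr0z => h.
  by rewrite ler1z -gtz0_ge1.
have pT : pos_semidef (w^-1 *: invmx S - Z).
  split.
    by rewrite linearB /= linearZ /= (pos_def_sym (pos_def_inv pS)) (pos_def_sym pZ).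
  move=> v; rewrite -/(qf _ _) qfB qfZl ZE inv_immx_act_form//.
  by rewrite subr_ge0 mulrC ler_pdivlMr// mulrC.
have tZ : \tr (Z *m S) <= g%:R / w.
  have := tr_mul_ge0 pT pS; rewrite mulmxBl linearB /= -scalemxAl mulVmx ?pos_def_unit//.
  by rewrite linearZ /= mxtrace1 subr_ge0 mulrC.
apply: le_trans (_ : \det Z * \det S <= _).
  by rewrite ler_peMl// ltW// pos_def_det.
apply: le_trans (det_mul_le_tr pZ pS) _.
apply: lerXn2r => //; rewrite nnegrE; first exact: tr_mul_ge0 (pos_def_semidef pZ) pS.
by rewrite divr_ge0// ltW.
Qed.

Lemma near_maximal_det (tau : 'M[C]_g) : siegel_half_space tau ->
  exists2 N, Sp N & forall M, Sp M ->
    99 / 100 * \det (immx (siegel_act M tau)) <= \det (immx (siegel_act N tau)).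
Proof.
move=> hT; have [K HK] := det_immx_act_bounded hT.
pose E : set R := [set x | exists2 M, Sp M & x = \det (immx (siegel_act M tau))].
have E1 M : Sp M -> E (\det (immx (siegel_act M tau))) by move=> sM; exists M.
have sE : has_sup E.
  split; first by exists (\det (immx (siegel_act 1%:M tau))); apply: E1; exact: Sp1.
  by exists K => _ [M sM ->]; exact: HK.
have ub M : Sp M -> \det (immx (siegel_act M tau)) <= sup E.
  by move=> sM; apply: sup_upper_bound => //; exact: E1.
have s0 : 0 < sup E.
  apply: lt_le_trans (ub _ (Sp1 g)); apply: pos_def_det.
  by have [] := siegel_act_half_space (Sp1 g) hT.
have e0 : 0 < sup E / 100 by rewrite divr_gt0.
have [_ [N sN ->] HN] := sup_adherent e0 sE.
exists N => // M sM; move: HN (ub M sM); move: (sup E) (\det _) (\det _).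
by clear => x y z; lra.
Qed.

Lemma immx_levi U (tau : 'M[C]_g) : U \in unitmx ->
  immx (siegel_act (levi_mx U) tau) = intmx R U *m immx tau *m (intmx R U)^T.
Proof.
move=> uU; rewrite act_levi// {1}[tau]mxC_split intC_cmx mulmxDr mulmxDl.
by rewrite -scalemxAr -scalemxAl -cmx_tr -!cmxM immx_cmx.
Qed.

(* The constant comes from [(43 / 50)^2 < 99 / 100 - 1 / 4]. *)
Lemma height_ge (x y D : R) : 0 < D -> 0 < y -> `|x| <= 1 / 2 ->
  99 / 100 * D <= (x ^+ 2 + y ^+ 2) * D -> 43 / 50 <= y.
Proof.
move=> D0 y0 hx; rewrite ler_pM2r// => h.
have x2 : x ^+ 2 <= 1 / 4.
  by rewrite -real_normK ?num_real//; move: (normr_ge0 x) hx; nra.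
rewrite leNgt; apply/negP => yl.
have : y ^+ 2 < (43 / 50) ^+ 2 by rewrite ltrXn2r ?nnegrE ?ltW//; lra.
by move: x2 h; lra.
Qed.

Lemma normc_sqr (z : C) : normc z ^+ 2 = complex.Re z ^+ 2 + complex.Im z ^+ 2.
Proof. by case: z => a b; rewrite sqr_sqrtr// addr_ge0// sqr_ge0. Qed.

(** Make [v] the j-th basis vector, translate [tau_jj] to real part at most 1/2 in absolute value,
    and invert in the j-th plane. The first two moves keep the determinant and the last divides it
    by [|tau_jj|^2], so near maximality forces [|tau_jj|^2 >= 99/100]. *)
Lemma near_maximal_lower_bound N (tau : 'M[C]_g) : siegel_half_space tau -> Sp N ->
  (forall M, Sp M ->
    99 / 100 * \det (immx (siegel_act M tau)) <= \det (immx (siegel_act N tau))) ->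
  lower_bound (43 / 50) (immx (siegel_act N tau)).
Proof.
move=> hT sN H v [U uU [j vE]].
have hS := siegel_act_half_space sN hT; set s := siegel_act N tau in H hS *.
have sL := Sp_levi uU; have hL := siegel_act_half_space sL hS.
set s1 := siegel_act (levi_mx U) s in hL.
have [t Ht] := int_round (complex.Re (s1 j j)).
have sTr : Sp (translation_mx (t *: delta_mx j j)).
  by apply: Sp_translation; rewrite linearZ /= trmx_delta.
have hTr := siegel_act_half_space sTr hL.
set s2 := siegel_act (translation_mx _) s1 in hTr.
have sI := Sp_inversion j; have hI := siegel_act_half_space sI hTr.
have sLN := SpM sL sN; have sTLN := SpM sTr sLN.
have := H _ (SpM sI sTLN).
rewrite (siegel_actM sI sTLN hT) (siegel_actM sTr sLN hT) (siegel_actM sL sN hT).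
rewrite -/s -/s1 -/s2.
have e1 := det_immx_act sL hS; have e2 := det_immx_act sTr hL.
have e3 := det_immx_act sI hTr.
have vE2 : qf (immx s) (intmx R v) = complex.Im (s1 j j).
  have -> : complex.Im (s1 j j) = immx s1 j j by rewrite [RHS]mxE.
  rewrite /s1 immx_levi// -qf_delta qf_congr -rowE vE /intmx map_row //.
have s2E : s2 j j = s1 j j + t%:~R%:C.
  have e : (t *: delta_mx j j : 'M[int]_g) j j = t by rewrite !mxE !eqxx mulr1.
  by rewrite /s2 act_translation mxE [intC _ _ _ _]mxE e rmorph_int.
have e0 : normc (\det (automorphy_mx (levi_mx U) s)) ^+ 2 = 1.
  rewrite expr2 -ComplexField.Normc.normcM -expr2 det_automorphy_levi//.
  exact: ComplexField.Normc.normc1.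
rewrite e0 mul1r -/s1 in e1.
rewrite automorphy_translation det1 ComplexField.Normc.normc1 expr1n mul1r -/s2 in e2.
rewrite det_inversion s2E in e3.
set D := \det (immx (siegel_act _ s2)) in e3 *.
have D0 : 0 < D by apply: pos_def_det; case: hI.
have y0 : 0 < complex.Im (s1 j j).
  by have := pos_def_diag j (proj2 hL); rewrite mxE.
rewrite e1 e2 e3 vE2 normc_sqr; clear e1 e2 e3 vE2 s2E; move: D (s1 j j) D0 y0 Ht.
by clear => D [a b] /= D0 b0 ht; rewrite addr0; exact: height_ge.
Qed.

Lemma siegel_reduction (l : R) : reduction g l -> exists c, forall tau : 'M[C]_g,
  siegel_half_space tau -> exists2 N, Sp N &
    let Z := invmx (immx (siegel_act N tau)) in
    (forall i, Z i i <= c) /\ (forall i : 'I_g, i.+1 = g -> Z i i <= l / (43 / 50)).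
Proof.
move=> [c Hc]; exists (c / (43 / 50)) => tau hT.
have [N sN HN] := near_maximal_det hT.
have hS := siegel_act_half_space sN hT.
have [||U uU HU] := Hc _ (43 / 50) (proj2 hS); first by lra.
  exact: near_maximal_lower_bound HN.
exists (levi_mx U *m N); first by apply: SpM => //; exact: Sp_levi.
by rewrite siegel_actM//; [rewrite immx_levi | exact: Sp_levi].
Qed.

End SiegelReduction.

(** * Unconditionally convergent sums *)

Section UnconditionalSums.
Variables (R : realType) (I : choiceType).
Local Notation C := R[i].
Local Notation normc := (@ComplexField.Normc.normc R).
Implicit Types (x : I -> C) (s : C).

Definition has_sum x s : Prop :=
  forall e : R, 0 < e -> exists A0 : {fset I}, forall A : {fset I},
    (A0 `<=` A)%fset -> normc (s - \sum_(i <- A) x i) < e.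

Lemma normcD_le (z w : C) : normc (z + w) <= normc z + normc w.
Proof. exact: le_normcD. Qed.

Lemma normc_ge0 (z : C) : 0 <= normc z.
Proof. by case: z => a b; exact: sqrtr_ge0. Qed.

Lemma normc_sum (J : Type) (r : seq J) (P : pred J) (F : J -> C) :
  normc (\sum_(i <- r | P i) F i) <= \sum_(i <- r | P i) normc (F i).
Proof.
elim/big_ind2: _ => //; first by rewrite ComplexField.Normc.normc0.
by move=> a b c d h1 h2; apply: le_trans (normcD_le _ _) _; exact: lerD.
Qed.

Lemma has_sum_cvg x s :
  summability.partial_sum (x : I -> C^o) @ summability.totally --> (s : C^o) ->
  has_sum x s.
Proof.
move=> H e e0; have e0' : 0 < e%:C by rewrite ltcR.
move/cvgrPdist_lt: H => /(_ summability.totally_filter _ e0') [A0 _ HA].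
exists A0 => A /HA /=; rewrite /summability.partial_sum -(big_seq_fsetE _ _ xpredT x) /=.
by rewrite norm_normc ltcR.
Qed.

Lemma le_abs_Re (z : C) : `|complex.Re z| <= normc z.
Proof. by have := normc_ge_Re z; rewrite norm_normc lecR. Qed.

Lemma normc_le_ReIm (z : C) : normc z <= `|complex.Re z| + `|complex.Im z|.
Proof.
rewrite -(@ler_pXn2r _ 2) ?nnegrE ?normc_ge0 ?addr_ge0//.
rewrite normc_sqr -[complex.Re z ^+ 2]real_normK ?num_real//.
rewrite -[complex.Im z ^+ 2]real_normK ?num_real//.
by move: (normr_ge0 (complex.Re z)) (normr_ge0 (complex.Im z)); nra.
Qed.

Lemma le_abs_Im (z : C) : `|complex.Im z| <= normc z.
Proof.
rewrite -(@ler_pXn2r _ 2) ?nnegrE ?normc_ge0//.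
by rewrite normc_sqr real_normK ?num_real// lerDr sqr_ge0.
Qed.

(** The terms of either sign form a subset of [A], on which the sum of absolute values is the
    absolute value of the sum. *)
Lemma sum_abs_le (A : {fset I}) (y : I -> R) (d : R) :
  (forall B : {fset I}, (B `<=` A)%fset -> `|\sum_(i <- B) y i| <= d) ->
  \sum_(i <- A) `|y i| <= 2 * d.
Proof.
move=> H; rewrite (big_fsetID _ (fun i => 0 <= y i)) /=.
set B1 := [fset _ in _ | _]%fset; set B2 := [fset _ in _ | _]%fset.
have s1 : (B1 `<=` A)%fset by apply/fsubsetP => i; rewrite !inE => /andP[].
have s2 : (B2 `<=` A)%fset by apply/fsubsetP => i; rewrite !inE => /andP[].
rewrite mulr2n mulrDl mul1r; apply: lerD.
  apply: le_trans (H _ s1); apply: le_trans (ler_norm _).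
  rewrite le_eqVlt; apply/orP; left; apply/eqP; rewrite !big_seq.
  by apply: eq_bigr => i; rewrite !inE => /andP[_ h]; rewrite ger0_norm.
apply: le_trans (H _ s2); rewrite -normrN; apply: le_trans (ler_norm _).
rewrite -sumrN le_eqVlt; apply/orP; left; apply/eqP; rewrite !big_seq.
by apply: eq_bigr => i; rewrite !inE => /andP[_ h]; rewrite ler0_norm// ltW// ltNge.
Qed.

Lemma sum_fsetU (A B : {fset I}) (V : zmodType) (x : I -> V) :
  [disjoint A & B]%fset ->
  \sum_(i <- (A `|` B)%fset) x i = \sum_(i <- A) x i + \sum_(i <- B) x i.
Proof.
move=> /fdisjointP d; rewrite (big_fsetID _ (mem A)) /=.
congr (_ + _); apply: eq_fbigl => i; rewrite !inE /=.
  by case: (i \in A); rewrite ?andbF.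
by case iA: (i \in A); rewrite ?andbF ?andbT//= (negbTE (d _ iA)).
Qed.

(** Unconditional convergence implies absolute convergence: all sums over finite sets away from [A0]
    are small, so [sum_abs_le] applies to real and imaginary parts. *)
Lemma has_sum_tail x s (e : R) : has_sum x s -> 0 < e ->
  exists A0 : {fset I}, forall B : {fset I}, [disjoint A0 & B]%fset ->
    \sum_(i <- B) normc (x i) <= e.
Proof.
(* A sum off [A0] is a difference of two errors, hence at most [e / 4]; [sum_abs_le] doubles this
   for each of the two parts. *)
move=> H e0; have e8 : 0 < e / 8 by rewrite divr_gt0.
have [A0 HA] := H _ e8; exists A0 => B dB.
have small D : (D `<=` B)%fset -> normc (\sum_(i <- D) x i) <= e / 4.
  move=> sD; have dD : [disjoint A0 & D]%fset by exact: fdisjointWr dB.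
  have h1 := HA _ (fsubset_refl A0); have h2 := HA _ (fsubsetUl A0 D).
  rewrite sum_fsetU// opprD addrA in h2.
  have -> : \sum_(i <- D) x i = (s - \sum_(i <- A0) x i)
     - (s - \sum_(i <- A0) x i - \sum_(i <- D) x i) by rewrite opprB addrCA subrr addr0.
  apply: le_trans (normcD_le _ _) _; rewrite normcN.
  by move: h1 h2; lra.
apply: le_trans (ler_sum _ (fun i _ => normc_le_ReIm (x i))) _.
rewrite big_split /=.
have -> : e = 2 * (e / 4) + 2 * (e / 4) by field.
apply: lerD; apply: sum_abs_le => D sD; apply: le_trans (small D sD).
  by rewrite -(raddf_sum (@complex.Re R : Rcomplex R -> R)) le_abs_Re.
by rewrite -(raddf_sum (@complex.Im R : Rcomplex R -> R)) le_abs_Im.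
Qed.

Lemma has_sum_bounded x s : has_sum x s ->
  exists K : R, forall B : {fset I}, \sum_(i <- B) normc (x i) <= K.
Proof.
move=> H; have [A0 HA] := has_sum_tail H ltr01.
exists (\sum_(i <- A0) normc (x i) + 1) => B.
rewrite -(fsetID A0 B) sum_fsetU; last first.
  by apply/fdisjointP => i; rewrite !inE => /andP[_ h]; rewrite h.
apply: lerD; last first.
  apply: HA; apply/fdisjointP => i iA; rewrite !inE iA //.
rewrite [leRHS](big_fsetID _ (fun i => i \in B)) /=.
rewrite -[leLHS]addr0; apply: lerD; last by apply: sumr_ge0 => i _; exact: normc_ge0.
rewrite le_eqVlt; apply/orP; left; apply/eqP; apply: eq_fbigl => i.
by rewrite !inE andbC.
Qed.

Lemma normc_has_sum_le x s (K : R) : has_sum x s ->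
  (forall B : {fset I}, \sum_(i <- B) normc (x i) <= K) -> normc s <= K.
Proof.
move=> H HK; apply/ler_addgt0Pr => e e0; have [A HA] := H _ e0.
have := HA _ (fsubset_refl A).
rewrite -{2}[s](subrK (\sum_(i <- A) x i)) => h.
apply: le_trans (normcD_le _ _) _; rewrite addrC; apply: lerD; last exact: ltW.
exact: le_trans (normc_sum _ _ _) (HK A).
Qed.

Lemma has_sum_zero x s : has_sum x s -> (forall i, x i = 0) -> s = 0.
Proof.
move=> H H0; apply: ComplexField.Normc.eq0_normc; apply/eqP.
rewrite eq_le normc_ge0 andbT; apply: normc_has_sum_le H _ => B.
by rewrite big1// => i _; rewrite H0 ComplexField.Normc.normc0.
Qed.

Lemma has_sumB x y s t : has_sum x s -> has_sum y t ->
  has_sum (fun i => x i - y i) (s - t).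
Proof.
move=> Hx Hy e e0; have e2 : 0 < e / 2 by rewrite divr_gt0.
have [A HA] := Hx _ e2; have [B HB] := Hy _ e2.
exists (A `|` B)%fset => D; rewrite fsubUset => /andP[sA sB].
have -> : s - t - \sum_(i <- D) (x i - y i)
    = (s - \sum_(i <- D) x i) - (t - \sum_(i <- D) y i) by rewrite sumrB; ring.
apply: le_lt_trans (normcD_le _ _) _; rewrite normcN.
have := HA D sA; have := HB D sB; lra.
Qed.

Lemma has_sum_approx x s (e : R) (A0 G : {fset I}) : has_sum x s ->
  (forall B : {fset I}, [disjoint A0 & B]%fset -> \sum_(i <- B) normc (x i) <= e) ->
  (A0 `<=` G)%fset -> normc (s - \sum_(i <- G) x i) <= e.
Proof.
move=> H HA sG; apply/ler_addgt0Pr => d d0; have [A1 HA1] := H _ d0.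
have := HA1 _ (fsubsetUr G A1).
rewrite -[(G `|` A1)%fset](fsetID G) sum_fsetU; last first.
  by apply/fdisjointP => i; rewrite !inE => /andP[_ ->].
have -> : ((G `|` A1) `&` G = G)%fset by apply/fsetIidPr; exact: fsubsetUl.
set D := (_ `\` _)%fset => h.
have dD : [disjoint A0 & D]%fset.
  by apply/fdisjointP => i iA; rewrite !inE (fsubsetP sG _ iA).
have := le_trans (normc_sum _ _ _) (HA _ dD).
have -> : s - \sum_(i <- G) x i =
  (s - (\sum_(i <- G) x i + \sum_(i <- D) x i)) + \sum_(i <- D) x i by ring.
move=> h2; apply: le_trans (normcD_le _ _) _; rewrite addrC.
by apply: lerD => //; exact: ltW.
Qed.

End UnconditionalSums.

(** * Characters and polynomials on circles *)

Section Characters.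
Variable R : realType.
Local Notation C := R[i].
Local Notation normc := (@ComplexField.Normc.normc R).

Definition expi (t : R) : C := cos t +i* sin t.

Lemma expi0 : expi 0 = 1.
Proof. by rewrite /expi cos0 sin0. Qed.

Lemma expiD s t : expi (s + t) = expi s * expi t.
Proof. by rewrite /expi cosD sinD; simpc; rewrite [sin s * _ + _]addrC. Qed.

Lemma expi_sum (J : Type) (r : seq J) (P : pred J) (F : J -> R) :
  expi (\sum_(j <- r | P j) F j) = \prod_(j <- r | P j) expi (F j).
Proof. by apply: (big_morph _ expiD expi0). Qed.

Lemma expiN t : expi (- t) = (expi t)^*%C.
Proof. by rewrite /expi cosN sinN. Qed.

Lemma expi_conj t : expi t * (expi t)^*%C = 1.
Proof. by rewrite -expiN -expiD subrr expi0. Qed.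

Lemma expiMn t n : expi (t *+ n) = expi t ^+ n.
Proof. by elim: n => [|n IH]; rewrite ?mulr0n ?expi0 ?expr0// mulrS exprS expiD IH. Qed.

Lemma normc_expi t : normc (expi t) = 1.
Proof. by rewrite /expi /= cos2Dsin2 sqrtr1. Qed.

Lemma cexpE (z : C) : cexp z = (expR (complex.Re z))%:C * expi (complex.Im z).
Proof. by []. Qed.

Lemma cexpD (z w : C) : cexp (z + w) = cexp z * cexp w.
Proof.
rewrite !cexpE; case: z => a b; case: w => c d /=.
by rewrite expRD expiD rmorphM /= mulrACA.
Qed.

Lemma normc_real (x : R) : normc x%:C = `|x|.
Proof. by rewrite /= expr0n /= addr0 sqrtr_sqr. Qed.

Lemma expi_2pi_neq1 (x : R) : 0 < `|x| < 1 -> expi (2 * pi * x) != 1.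
Proof.
have pos (y : R) : 0 < y < 1 -> expi (2 * pi * y) != 1.
  move=> /andP[y0 y1]; apply/eqP => -[h _].
  have p0 := pi_gt0 R.
  have : 0 < sin (pi * y) by rewrite sin_gt0_pi// mulr_gt0//= gtr_pMr.
  have : cos (2 * pi * y) = 1 - sin (pi * y) ^+ 2 *+ 2.
    have -> : 2 * pi * y = (pi * y) *+ 2 by rewrite mulr2n; ring.
    by rewrite cos_mulr2n cos2sin2 mulrnBl addrAC mulr2n addrK.
  rewrite h; nra.
move=> /andP[x0 x1]; have [xp|xp] := leP 0 x.
  by apply: pos; rewrite -(ger0_norm xp) x0.
have := pos (- x); rewrite -(ltr0_norm xp) x0 x1 => /(_ isT).
rewrite (ltr0_norm xp) mulrN expiN; apply: contra_neq => ->.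
by rewrite conjc1.
Qed.

Lemma expi_2pi_int (d : int) : expi (2 * pi * d%:~R) = 1.
Proof.
have nat n : expi (2 * pi * n%:R) = 1.
  have -> : 2 * pi = pi *+ 2 :> R by rewrite mulr_natl.
  by rewrite mulr_natr expiMn /expi cos2pi sin2pi expr1n.
case: d => n; first exact: nat.
have h : expi (2 * pi * (Posz n.+1)%:~R) = 1 := nat n.+1.
by rewrite NegzE mulrNz mulrN expiN h conjc1.
Qed.

Lemma sum_expi_eq0 (N : nat) (d : int) : (0 < absz d < N)%N ->
  \sum_(m < N) expi (2 * pi * (d%:~R / N%:R) * m%:R) = 0.
Proof.
move=> /andP[d0 dN]; have N0 : 0 < N%:R :> R by rewrite ltr0n; lia.
set z := expi (2 * pi * (d%:~R / N%:R)).
have z1 : z != 1.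
  apply: expi_2pi_neq1; rewrite normrM normfV (gtr0_norm N0) -intr_norm -natr_absz.
  apply/andP; split; first by rewrite divr_gt0// ltr0n.
  by rewrite ltr_pdivrMr// mul1r ltr_nat.
have zN : z ^+ N = 1.
  rewrite /z -expiMn -[X in expi X]mulr_natr -mulrA divfK ?gt_eqF//.
  by rewrite expi_2pi_int.
under eq_bigr => m _ do rewrite mulr_natr expiMn.
have := subrX1 z N; rewrite zN subrr => /esym/eqP.
by rewrite mulf_eq0 subr_eq0 (negbTE z1) => /eqP.
Qed.

Lemma normc_sqr_conj (z : C) : (normc z ^+ 2)%:C = z * z^*%C.
Proof. by rewrite -sqr_normc norm_normc rmorphXn. Qed.

(* Parseval's identity for the mean over the sample points [j : J]. *)
Lemma bessel_finite (I : choiceType) (J : finType) (G : {fset I}) (c : I -> C)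
    (chi : I -> J -> C) (K : R) : (0 < #|J|)%N ->
  (forall i j, normc (chi i j) = 1) ->
  (forall i k, i \in G -> k \in G -> i != k ->
     \sum_j chi i j * (chi k j)^*%C = 0) ->
  (forall j, normc (\sum_(i <- G) c i * chi i j) <= K) ->
  \sum_(i <- G) normc (c i) ^+ 2 <= K ^+ 2.
Proof.
move=> J0 chi1 ortho HK; pose p j := \sum_(i <- G) c i * chi i j.
have E : \sum_j normc (p j) ^+ 2 = #|J|%:R * \sum_(i <- G) normc (c i) ^+ 2.
  apply: (@complexI R); rewrite rmorphM !rmorph_sum rmorph_nat /=.
  under eq_bigr => j _.
    rewrite normc_sqr_conj /p rmorph_sum big_distrlr /=.
    over.
  rewrite exchange_big /= mulr_sumr !big_seq; apply: eq_bigr => i iG.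
  rewrite exchange_big /= (big_fsetD1 i)//= [X in _ + X](_ : _ = 0) ?addr0; last first.
    rewrite big_seq big1// => k; rewrite !inE => /andP[ki kG].
    under eq_bigr => j _ do rewrite rmorphM mulrACA.
    by rewrite -mulr_sumr ortho ?mulr0// eq_sym.
  under eq_bigr => j _.
    rewrite rmorphM mulrACA -normc_sqr_conj -[X in _ * X]normc_sqr_conj chi1 expr1n mulr1.
    over.
  by rewrite sumr_const mulr_natl.
have n0 : 0 < #|J|%:R :> R by rewrite ltr0n.
rewrite -(ler_pM2l n0) -E.
have -> : #|J|%:R * K ^+ 2 = \sum_(j : J) K ^+ 2 by rewrite sumr_const mulr_natl.
apply: ler_sum => j _; apply: lerXn2r; rewrite ?nnegrE ?normc_ge0//; last exact: HK.
exact: le_trans (normc_ge0 _) (HK j).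
Qed.

(* [p.[1]] is an average of [p] over the N-th roots of unity times [rho], with weights of
   modulus at most [1 / (1 - 1 / rho)]. *)
Lemma poly_weak_max (p : {poly C}) (rho K : R) : 1 < rho ->
  (forall x : R, normc p.[rho%:C * expi (2 * pi * x)] <= K) ->
  normc p.[1] <= K * (1 - rho^-1)^-1.
Proof.
(* More sample points than coefficients, so that distinct exponents stay distinct modulo [N]; the
   successor keeps [N] positive for [p = 0]. *)
move=> r1 HK; pose N := (size p).+1; have r0 : 0 < rho by exact: lt_trans r1.
have N0 : 0 < N%:R :> R by rewrite ltr0n.
pose chi (n : nat) (m : nat) := expi (2 * pi * (n%:R / N%:R) * m%:R).
have ortho (n k : 'I_N) : \sum_(m < N) chi n m * (chi k m)^*%C = (n == k)%:R * N%:R.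
  have [->|nk] := eqVneq n k.
    rewrite mul1r; under eq_bigr => m _ do rewrite expi_conj.
    by rewrite sumr_const card_ord.
  rewrite mul0r.
  transitivity (\sum_(m < N) expi (2 * pi * ((n%:Z - k%:Z)%:~R / N%:R) * m%:R)).
    apply: eq_bigr => m _; rewrite /chi -expiN -expiD; congr expi.
    by rewrite intrB mulrBl mulrBr mulrBl.
  apply: sum_expi_eq0.
  have := ltn_ord n; have := ltn_ord k; move: nk; rewrite -val_eqE /=; lia.
have normc_chi n m : normc (chi n m)^*%C = 1 by rewrite -expiN normc_expi.
have chiE n m : (rho%:C * expi (2 * pi * (m%:R / N%:R))) ^+ n
    = (rho ^+ n)%:C * chi n m.
  rewrite exprMn -expiMn rmorphXn; congr (_ * expi _); rewrite -mulr_natr; ring.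
move: chi ortho normc_chi chiE => chi ortho normc_chi chiE.
have pE z : p.[z] = \sum_(n < N) p`_n * z ^+ n.
  by rewrite horner_coef /N big_ord_recr /= nth_default// mul0r addr0.
have E : N%:R * p.[1] = \sum_(m < N) p.[rho%:C * expi (2 * pi * (m%:R / N%:R))] *
    \sum_(k < N) ((rho^-1) ^+ k)%:C * (chi k m)^*%C.
  transitivity (\sum_(n < N) \sum_(k < N) (p`_n * (rho ^+ n)%:C * (rho^-1 ^+ k)%:C) *
      \sum_(m < N) chi n m * (chi k m)^*%C).
    rewrite pE mulr_sumr; apply: eq_bigr => n _.
    rewrite (bigD1 n)// [X in _ = _ + X]big1 ?addr0 => [|k kn].
      have e : (rho ^+ n)%:C * (rho^-1 ^+ n)%:C = 1 :> C.
        by rewrite -rmorphM -exprMn divff ?gt_eqF// expr1n rmorph1.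
      by rewrite ortho eqxx mul1r expr1n mulr1 -[p`_n * _ * _]mulrA e mulr1 mulrC.
    by rewrite ortho eq_sym (negbTE kn) mul0r mulr0.
  transitivity (\sum_(n < N) \sum_(k < N) \sum_(m < N)
      (p`_n * ((rho ^+ n)%:C * chi n m)) * ((rho^-1 ^+ k)%:C * (chi k m)^*%C)).
    apply: eq_bigr => n _; apply: eq_bigr => k _; rewrite mulr_sumr.
    by apply: eq_bigr => m _; ring.
  rewrite exchange_big; under eq_bigr => k _ do rewrite exchange_big.
  rewrite exchange_big; apply: eq_bigr => m _; rewrite pE big_distrlr exchange_big.
  by apply: eq_bigr => n _; apply: eq_bigr => k _; rewrite chiE.
rewrite -(ler_pM2l N0).
have -> : N%:R * normc p.[1] = normc (N%:R * p.[1]).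
  rewrite ComplexField.Normc.normcM; congr (_ * _).
  by rewrite -(rmorph_nat (real_complex R)) normc_real normr_nat.
rewrite E; apply: le_trans (normc_sum _ _ _) _.
have -> : N%:R * (K * (1 - rho^-1)^-1) = \sum_(m < N) K * (1 - rho^-1)^-1.
  by rewrite sumr_const card_ord mulr_natl.
apply: ler_sum => m _; rewrite ComplexField.Normc.normcM.
apply: ler_pM; rewrite ?normc_ge0//.
apply: le_trans (normc_sum _ _ _) _.
have q1 : rho^-1 < 1 by rewrite invf_lt1.
have q0 : 0 < rho^-1 by rewrite invr_gt0.
under eq_bigr => k _.
  rewrite ComplexField.Normc.normcM normc_chi mulr1 normc_real normrX ger0_norm ?(ltW q0)//.
  over.
rewrite -[leRHS]mul1r ler_pdivlMr ?subr_gt0// -[leLHS]opprK -mulrN opprB mulrC -subrX1 opprB.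
by rewrite gerBl exprn_ge0// ltW.
Qed.

Lemma powers_bounded_le1 (x L : R) : 0 <= x -> (forall k : nat, x ^+ k <= L) -> x <= 1.
Proof.
move=> x0 H; rewrite leNgt; apply/negP => x1.
have bern k : 1 + (x - 1) *+ k <= x ^+ k.
  elim: k => [|k IH]; first by rewrite mulr0n addr0 expr0.
  rewrite exprS mulrS; have : 0 <= (x - 1) *+ k by rewrite mulrn_wge0// subr_ge0 ltW.
  move: IH; move: (_ *+ k) (x ^+ k) => a b; nra.
pose k := (Num.truncn (L / (x - 1))).+1.
have := truncnS_gt (L / (x - 1)); rewrite -/k ltr_pdivrMr ?subr_gt0// => h.
have := le_trans (bern k) (H k); rewrite -[_ *+ k]mulr_natl; move: h; lra.
Qed.

(* Applying the weak bound to [p ^+ k] and letting k grow removes the constant. *)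
Lemma poly_max_modulus (p : {poly C}) (rho K : R) : 1 < rho ->
  (forall x : R, normc p.[rho%:C * expi (2 * pi * x)] <= K) -> normc p.[1] <= K.
Proof.
move=> r1 HK; set L := (1 - rho^-1)^-1.
have K0 : 0 <= K by apply: le_trans (normc_ge0 _) (HK 0).
have nX z k : normc (z ^+ k) = normc z ^+ k.
  by elim: k => [|k IH]; rewrite ?expr0 ?ComplexField.Normc.normc1// !exprS ComplexField.Normc.normcM IH.
have H k : normc p.[1] ^+ k <= K ^+ k * L.
  rewrite -nX -horner_exp; apply: poly_weak_max r1 _ => x.
  by rewrite horner_exp nX; apply: lerXn2r; rewrite ?nnegrE ?normc_ge0.
have [K1|K1] := eqVneq K 0; first by have := H 1%N; rewrite !expr1 K1 mul0r.
have Kp : 0 < K by rewrite lt_neqAle eq_sym K1.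
rewrite -(@ler_pM2r _ K^-1) ?invr_gt0// divff//.
apply: (@powers_bounded_le1 _ L); first by rewrite divr_ge0 ?normc_ge0.
by move=> k; rewrite expr_div_n ler_pdivrMr ?exprn_gt0// mulrC.
Qed.

End Characters.

(** * Fourier expansions of cusp forms *)

Section FourierExpansions.
Variables (R : realType) (g : nat).
Local Notation C := R[i].
Local Notation normc := (@ComplexField.Normc.normc R).
Implicit Types (F : 'M[C]_g -> C) (a c : 'M[rat]_g -> C) (T : 'M[rat]_g).
Implicit Types (tau : 'M[C]_g).

Definition ratmx T : 'M[R]_g := map_mx ratr T.

Definition fterm a tau T : C :=
  a T * cexp (0 +i* pi * \tr (map_mx ratr T *m tau)).

Lemma ratrC (q : rat) : (ratr q)%:C = ratr q :> C.
Proof. exact: (fmorph_rat (real_complex R)). Qed.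

Lemma trace_cmx_mul (A : 'M[R]_g) tau :
  \tr (cmx A *m tau) = \tr (A *m remx tau) +i* \tr (A *m immx tau).
Proof.
rewrite {1}[tau]mxC_split mulmxDr -scalemxAr -!cmxM linearD linearZ /=.
have tc (B : 'M[R]_g) : \tr (cmx B) = (\tr B)%:C.
  by rewrite /mxtrace rmorph_sum; apply: eq_bigr => i _; rewrite mxE.
by rewrite !tc; simpc.
Qed.

Lemma ftermE a tau T : fterm a tau T =
  a T * ((expR (- (pi * \tr (ratmx T *m immx tau))))%:C
         * expi (pi * \tr (ratmx T *m remx tau))).
Proof.
have E : map_mx ratr T = cmx (ratmx T) :> 'M[C]_g.
  by apply/matrixP=> i j; rewrite !mxE ratrC.
rewrite /fterm E trace_cmx_mul; move: (\tr _) (\tr _) => y x.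
have -> : (0 +i* pi) * (x +i* y) = (- (pi * y)) +i* (pi * x) :> C by simpc.
by rewrite cexpE.
Qed.

Lemma normc_fterm a tau T :
  normc (fterm a tau T) = normc (a T) * expR (- (pi * \tr (ratmx T *m immx tau))).
Proof.
rewrite ftermE !ComplexField.Normc.normcM normc_expi mulr1 normc_real ger0_norm// expR_ge0.
Qed.

Lemma fourier_has_sum F a tau : fourier_expansion F a -> siegel_half_space tau ->
  has_sum (fterm a tau) (F tau).
Proof. by move=> [_ H] hT; apply: has_sum_cvg; exact: H. Qed.

Definition cuspidal a : Prop :=
  forall T, a T != 0 -> half_integral T /\ pos_def (ratmx T).

Lemma normc_fterm_le a tau tau1 T : cuspidal a ->
  pos_semidef (immx tau - immx tau1) ->
  normc (fterm a tau T) <= normc (fterm a tau1 T).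
Proof.
move=> Ha pY; have [a0|a0] := eqVneq (a T) 0.
  by rewrite /fterm a0 !mul0r.
have [_ pT] := Ha T a0.
rewrite !normc_fterm ler_wpM2l ?normc_ge0// ler_expR lerN2 ler_wpM2l ?pi_ge0//.
by have := tr_mul_ge0 pY pT; rewrite mxtrace_mulC mulmxBr linearB /= subr_ge0.
Qed.

(** Records the integrality of [2 T] as a matrix identity, the form in which it passes to [T[U]] and
    enters the orthogonality of characters. *)
Definition twice_integral T : Prop :=
  T^T = T /\ exists Z : 'M[int]_g, 2 *: T = map_mx intr Z.

Lemma half_integral_twice T : half_integral T -> twice_integral T.
Proof.
move=> [sT _ oT]; split=> //; exists (\matrix_(i, j) Num.floor (2 * T i j)).
by apply/matrixP=> i j; rewrite !mxE; have /floorK -> := oT i j.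
Qed.

Lemma twice_integral_ratmx T : twice_integral T ->
  exists Z : 'M[int]_g, 2 *: ratmx T = intmx R Z.
Proof.
move=> [_ [Z /matrixP HZ]]; exists Z; apply/matrixP=> i j; have := HZ i j.
rewrite !mxE => /(congr1 (ratr : rat -> R)).
by rewrite rmorphM /= ratr_nat ratr_int.
Qed.

Lemma half_integral_det T : half_integral T -> pos_def (ratmx T) ->
  1 <= 2 ^+ g * \det (ratmx T).
Proof.
move=> /half_integral_twice/twice_integral_ratmx[Z ZE] pT.
have := pos_def_det pT; rewrite -(pmulr_rgt0 _ (exprn_gt0 g (ltr0Sn R 1))).
by rewrite -detZ ZE /intmx det_map_mx ltr0z ler1z gtz0_ge1.
Qed.

Lemma half_integral_diag T i : half_integral T -> pos_def (ratmx T) ->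
  exists n : nat, ratmx T i i = n.+1%:R.
Proof.
move=> hT pT; have [_ /(_ i)/intrP[y Hy] _] := hT.
have yE : ratmx T i i = y%:~R by rewrite mxE Hy ratr_int.
have := pos_def_diag i pT; rewrite yE ltr0z.
by case: y yE {Hy} => [[|n]|n] // yE _; exists n.
Qed.

Lemma power_exp_bound (n : nat) (t d : R) : (0 < n)%N -> 0 < t ->
  d <= 2 ^+ n * t ^+ n -> d * expR (- (pi / 2 * t)) <= 4 ^+ n * n`!%:R.
Proof.
move=> n0 t0 hd; have p0 := pi_ge2 R; pose s := pi / 2 * t.
have s0 : 0 < s by rewrite mulr_gt0// divr_gt0// pi_gt0.
have ts : t <= s by rewrite /s ler_peMl ?(ltW t0)//; lra.
have f0 : 0 < n`!%:R :> R by rewrite ltr0n fact_gt0.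
have h : s ^+ n / n`!%:R <= expR s.
  have := expR_ge1Dxn n.-1 (ltW s0); rewrite prednK//; apply: le_trans.
  by rewrite lerDr.
rewrite -/s expRN ler_pdivrMr ?expR_gt0//; apply: le_trans hd _.
apply: le_trans (_ : 4 ^+ n * s ^+ n <= _); last first.
  by rewrite -mulrA ler_wpM2l ?exprn_ge0// mulrC -ler_pdivrMr.
apply: ler_pM; rewrite ?exprn_ge0// ?(ltW t0)//.
  by apply: lerXn2r; rewrite ?nnegrE//; lra.
by apply: lerXn2r; rewrite ?nnegrE// ltW.
Qed.

Lemma immx_i (X : 'M[R]_g) : immx ('i *: cmx X) = X.
Proof. by apply/matrixP=> i j; rewrite !mxE; simpc. Qed.

Lemma siegel_i (Y : 'M[R]_g) : pos_def Y -> siegel_half_space ('i *: cmx Y).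
Proof.
move=> pY; split; first by rewrite linearZ /= -cmx_tr pos_def_sym.
by rewrite -/(immx _) immx_i.
Qed.

(** Half of the exponential decay absorbs the determinant, since
    [det Y <= det(2 T) det Y <= (2 tr(T Y))^g]; the other half compares the series with the
    absolutely convergent one at [i k / 2]. *)
Lemma fourier_bound F a (k : R) : (0 < g)%N -> fourier_expansion F a ->
  cuspidal a -> 0 < k -> exists K, forall tau, siegel_half_space tau ->
  pos_def (immx tau - k%:M) -> normc (F tau) * \det (immx tau) <= K.
Proof.
move=> g0 HF Ha k0; pose tau0 : 'M[C]_g := 'i *: cmx (k / 2)%:M.
have pk : pos_def ((k / 2)%:M : 'M[R]_g).
  split; first by rewrite tr_scalar_mx.
  by move=> v v0; rewrite -/(qf _ _) qf_scalar mulr_gt0 ?sqnorm_gt0// divr_gt0.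
have h0 : siegel_half_space tau0 by exact: siegel_i.
have [K HK] := has_sum_bounded (fourier_has_sum HF h0).
pose c : R := 4 ^+ g * g`!%:R.
have c0 : 0 <= c by rewrite mulr_ge0// exprn_ge0.
exists (c * K) => tau hT pY; have [_ pT0] := hT; rewrite -/(immx tau) in pT0.
have d0 := pos_def_det pT0.
rewrite -ler_pdivlMr//; apply: (normc_has_sum_le (fourier_has_sum HF hT)) => B.
rewrite ler_pdivlMr// mulr_suml; apply: le_trans (_ : c * \sum_(T <- B) normc (fterm a tau0 T) <= _); last first.
  by rewrite ler_wpM2l.
rewrite mulr_sumr; apply: ler_sum => T _.
have [a0|a0] := eqVneq (a T) 0.
  by rewrite /fterm a0 !mul0r ComplexField.Normc.normc0 mul0r mulr0.
have [hlf pT] := Ha T a0; rewrite !normc_fterm immx_i -mulrA [leRHS]mulrCA; apply: ler_wpM2l; first exact: normc_ge0.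
set t := \tr (_ *m immx tau).
have tk : \tr (ratmx T *m (k / 2)%:M) <= t / 2.
  have -> : (k / 2)%:M = 2^-1 *: (k%:M : 'M[R]_g) by rewrite scale_scalar_mx mulrC.
  rewrite -scalemxAr linearZ /= mulrC ler_pM2r ?invr_gt0//.
  exact: tr_mul_le (pos_def_semidef pT) pY.
have dt := det_mul_le_tr pT pT0; rewrite -/t in dt.
have t0 : 0 < t.
  rewrite lt_neqAle (tr_mul_ge0 (pos_def_semidef pT) pT0) andbT eq_sym.
  apply/eqP => t0; move: dt; rewrite -/t t0 expr0n gtn_eqF//= leNgt.
  by rewrite mulr_gt0// pos_def_det.
have hd : \det (immx tau) <= 2 ^+ g * t ^+ g.
  apply: le_trans (_ : 2 ^+ g * (\det (ratmx T) * \det (immx tau)) <= _).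
    by rewrite mulrA ler_peMl ?(ltW d0)// half_integral_det.
  by rewrite ler_pM2l// exprn_gt0.
have := power_exp_bound g0 t0 hd; rewrite -/c => hc.
have -> : - (pi * t) = - (pi / 2 * t) - pi * (t / 2) by field.
rewrite expRD mulrAC mulrC mulrA mulrC [_ * \det _]mulrC.
apply: ler_pM; rewrite ?mulr_ge0 ?expR_ge0 ?(ltW d0)// ler_expR lerN2.
by rewrite -mulrA ler_wpM2l// pi_ge0.
Qed.

Lemma fterm_shift a tau T (z : C) i :
  fterm a (tau + z *: delta_mx i i) T =
  fterm a tau T * cexp (0 +i* pi * (z * (ratmx T i i)%:C)).
Proof.
rewrite /fterm -mulrA -cexpD; congr (_ * cexp _); rewrite -mulrDr; congr (_ * _).
rewrite mulmxDr linearD /= -scalemxAr linearZ /=; congr (_ + _ * _).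
rewrite -(mul_delta_mx (0 : 'I_1)) mulmxA mxtrace_mulC mulmxA /mxtrace big_ord1.
by rewrite -colE -rowE !mxE ratrC.
Qed.

Lemma immx_shift tau x (e : R) i :
  immx (tau + (x -i* e) *: delta_mx i i) = immx tau - e *: delta_mx i i.
Proof.
apply/matrixP=> k l; rewrite !mxE; case: (tau k l) => u v /=.
by case: (_ && _); rewrite ?mulr1n ?mulr0n /=; simpc.
Qed.

Lemma siegel_shift tau x (e : R) i : siegel_half_space tau ->
  pos_def (immx tau - e *: delta_mx i i) ->
  siegel_half_space (tau + (x -i* e) *: delta_mx i i).
Proof.
move=> [tT _] pY; split; last by rewrite -/(immx _) immx_shift.
by rewrite linearD linearZ /= trmx_delta tT.
Qed.

(** Along [tau + z e_ii] a finite partial sum is a polynomial in [q = exp(pi i z)] without constant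
    term, because [T_ii >= 1]. The maximum principle for its quotient by [q] produces the factor
    [exp(- pi e)]. *)
Lemma cuspidal_descent F a tau i (e K : R) :
  fourier_expansion F a -> cuspidal a -> siegel_half_space tau -> 0 < e ->
  pos_def (immx tau - e *: delta_mx i i) ->
  (forall x : R, normc (F (tau + (x -i* e) *: delta_mx i i)) <= K) ->
  normc (F tau) <= K * expR (- (pi * e)).
Proof.
move=> HF Ha hT e0 pY HK; have [tT pT] := hT; have shift_im x := immx_shift tau x e i.
have shift_H x : siegel_half_space (tau + (x -i* e) *: delta_mx i i).
  exact: siegel_shift.
apply/ler_addgt0Pr => d d0; set rho := expR (pi * e).
have r1 : 1 < rho by rewrite /rho expR_gt1 mulr_gt0// pi_gt0.
have r0 : 0 < rho by exact: expR_gt0.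
have d2 : 0 < d / 2 by rewrite divr_gt0.
have [A0 HA] := has_sum_tail (fourier_has_sum HF (shift_H 0)) d2.
have HA' sigma B : pos_semidef (immx sigma - (immx tau - e *: delta_mx i i)) ->
   [disjoint A0 & B]%fset -> \sum_(T <- B) normc (fterm a sigma T) <= d / 2.
  move=> hs dB; apply: le_trans (HA B dB); apply: ler_sum => T _.
  by apply: normc_fterm_le => //; rewrite shift_im.
(* The exponent is [T_ii - 1]: one factor [q] has been divided out. *)
pose nT T := (Num.truncn (ratmx T i i)).-1.
have nE T : a T != 0 -> ratmx T i i = (nT T).+1%:R.
  move=> a0; have [h p] := Ha T a0; have [n nE] := half_integral_diag i h p.
  by rewrite /nT nE natrK.
pose p : {poly C} := \sum_(T <- A0) fterm a tau T *: 'X^(nT T).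
have p1 : p.[1] = \sum_(T <- A0) fterm a tau T.
  rewrite /p horner_sum; apply: eq_bigr => T _.
  by rewrite hornerZ hornerXn expr1n mulr1.
have hF : normc (F tau - p.[1]) <= d / 2.
  rewrite p1; apply: has_sum_approx (fourier_has_sum HF hT) _ (fsubset_refl A0) => B.
  apply: HA'; rewrite opprB addrCA subrr addr0; split.
    by rewrite linearZ /= trmx_delta.
  by move=> v; rewrite -/(qf _ _) qfZl qf_delta_mx mulr_ge0 ?sqr_ge0// ltW.
(* The point [rho e^(2 pi i x)] is the value of [exp(pi i z)] at [z = 2 x - i e]. *)
have px x : rho%:C * expi (2 * pi * x) * p.[rho%:C * expi (2 * pi * x)]
    = \sum_(T <- A0) fterm a (tau + ((2 * x) -i* e) *: delta_mx i i) T.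
  rewrite /p horner_sum mulr_sumr; apply: eq_bigr => T _.
  rewrite hornerZ hornerXn fterm_shift.
  have [a0|a0] := eqVneq (a T) 0; first by rewrite /fterm a0 !mul0r mulr0.
  rewrite mulrCA -exprS nE//; congr (_ * _).
  rewrite exprMn -expiMn -rmorphXn /rho -expRM_natr cexpE.
  by congr ((expR _)%:C * expi _); simpc => /=; ring.
have hp x : normc p.[rho%:C * expi (2 * pi * x)] <= rho^-1 * (K + d / 2).
  rewrite -(ler_pM2l r0) mulrA divff ?gt_eqF// mul1r.
  have -> : rho * normc p.[rho%:C * expi (2 * pi * x)] =
      normc (\sum_(T <- A0) fterm a (tau + ((2 * x) -i* e) *: delta_mx i i) T).
    by rewrite -px !ComplexField.Normc.normcM normc_expi mulr1 normc_real gtr0_norm.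
  set s := \sum_(T <- A0) _.
  have hs : normc (F (tau + ((2 * x) -i* e) *: delta_mx i i) - s) <= d / 2.
    apply: has_sum_approx (fourier_has_sum HF (shift_H _)) _ (fsubset_refl A0) => B.
    apply: HA'; rewrite shift_im subrr; split; first by rewrite trmx0.
    by move=> v; rewrite mulmx0 mul0mx mxE.
  have := HK (2 * x); move: hs; move: (F _) => w hs hw.
  rewrite -[s](subKr w) addrC; apply: le_trans (normcD_le _ _) _.
  by rewrite normcN addrC lerD.
have := poly_max_modulus r1 hp => hp1.
have -> : F tau = p.[1] + (F tau - p.[1]) by rewrite addrC subrK.
apply: le_trans (normcD_le _ _) _.
rewrite expRN -/rho; move: hp1 hF; rewrite mulrDr => hp1 hF.
have h3 : rho^-1 * (d / 2) <= d / 2.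
  by rewrite ler_piMl ?(ltW d2)// invf_le1// ltW.
rewrite mulrC; move: hp1 hF h3; move: (normc _) (normc _) (rho^-1 * K) (rho^-1 * _).
by clear => u v w z; lra.
Qed.

(** [bessel_finite] on a grid of symmetric matrices [X] fine enough to separate the finitely many
    [T] involved; the tail beyond [A0] costs [d], uniformly in [X]. *)
Lemma fourier_bessel c (K : R) : (forall T, c T != 0 -> twice_integral T) ->
  (forall X : 'M[R]_g, X^T = X -> exists2 s,
     has_sum (fun T => c T * expi (pi * \tr (ratmx T *m X))) s & normc s <= K) ->
  forall A : {fset 'M[rat]_g}, \sum_(T <- A) normc (c T) ^+ 2 <= K ^+ 2.
Proof.
move=> Hc HK A; have K0 : 0 <= K.
  have [s _ h] := HK 0 (trmx0 _ _ _); exact: le_trans (normc_ge0 _) h.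
have S0 : 0 <= \sum_(T <- A) normc (c T) ^+ 2.
  by apply: sumr_ge0 => T _; exact: sqr_ge0.
suff : Num.sqrt (\sum_(T <- A) normc (c T) ^+ 2) <= K.
  by move=> h; rewrite -(sqr_sqrtr S0); apply: lerXn2r; rewrite ?nnegrE ?sqrtr_ge0.
apply/ler_addgt0Pr => d d0.
have [s0 hs0 _] := HK 0 (trmx0 _ _ _).
have [A0 HA] := has_sum_tail hs0 d0.
have HA' (X : 'M[R]_g) B : [disjoint A0 & B]%fset ->
    \sum_(T <- B) normc (c T * expi (pi * \tr (ratmx T *m X))) <= d.
  move=> dB; apply: le_trans (HA B dB); apply: ler_sum => T _.
  by rewrite !ComplexField.Normc.normcM !normc_expi.
(* [G] contains [A0] to control the tail; [G1] keeps the [T] for which [Hc] provides integrality. *)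
pose G := (A `|` A0)%fset; pose G1 := [fset T in G | c T != 0]%fset.
have G1E T : (T \in G1) = (T \in G) && (c T != 0) by rewrite !inE.
have sum_G1 (V : zmodType) (f : 'M[rat]_g -> V) : (forall T, c T = 0 -> f T = 0) ->
    \sum_(T <- G) f T = \sum_(T <- G1) f T.
  move=> f0; apply/esym; apply: big_fset_incl.
    by apply/fsubsetP => T; rewrite !inE => /andP[].
  by move=> T TG; rewrite G1E TG /= negbK => /eqP; exact: f0.
(* [S] bounds every entry of [2 T] on [G1], so with [N > 2 S] two distinct such matrices differ in
   some entry by a nonzero integer of modulus below [N]. *)
pose S := \sum_(T <- G1) \sum_(p : 'I_g * 'I_g) `|2 * ratmx T p.1 p.2|.
pose N := (Num.truncn (2 * S)).+1.
have NS : 2 * S < N%:R by exact: truncnS_gt.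
have entry T i j : T \in G1 -> `|2 * ratmx T i j| <= S.
  move=> TG; rewrite /S (big_fsetD1 T)//= (bigD1 (i, j))//= -addrA lerDl addr_ge0//.
    by apply: sumr_ge0 => p _; exact: normr_ge0.
  by apply: sumr_ge0 => T' _; apply: sumr_ge0 => p _; exact: normr_ge0.
pose J := {ffun 'I_g * 'I_g -> 'I_N}.
(* Symmetrising keeps all [g^2] grid indices independent: against a symmetric [T] each ordered pair
   [(i, j)] contributes the character of frequency [2 T_ij / N]. *)
pose X (k : J) : 'M[R]_g :=
  \matrix_(i, j) (2 / N%:R * ((k (i, j) : nat)%:R + (k (j, i) : nat)%:R)).
have Xs k : (X k)^T = X k by apply/matrixP=> i j; rewrite !mxE addrC.
have N0 : 0 < N%:R :> R by rewrite ltr0n.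
have trX T k : T^T = T -> pi * \tr (ratmx T *m X k) =
    \sum_(p : 'I_g * 'I_g) 2 * pi * (2 * ratmx T p.1 p.2 / N%:R) * (k p : nat)%:R.
  move=> sT; have sym i j : ratmx T i j = ratmx T j i.
    by rewrite mxE [RHS]mxE -{1}sT mxE.
  transitivity (\sum_i \sum_j 2 * pi * (2 * ratmx T i j / N%:R) * (k (i, j) : nat)%:R);
    last by rewrite pair_big /=; apply: eq_bigr => -[i j] _.
  pose f i j := 2 * pi * (ratmx T i j / N%:R) * (k (i, j) : nat)%:R.
  transitivity (\sum_i \sum_j f i j + \sum_j \sum_i f i j); last first.
    rewrite [X in _ + X]exchange_big /= -big_split; apply: eq_bigr => i _ /=.
    by rewrite -big_split; apply: eq_bigr => j _; rewrite /f /=; ring.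
  rewrite -big_split /mxtrace mulr_sumr; apply: eq_bigr => i _ /=.
  rewrite -big_split mxE mulr_sumr; apply: eq_bigr => j _ /=.
  by rewrite [X k _ _]mxE /f (sym j i) /=; ring.
have J0 : (0 < #|J|)%N.
  by apply/card_gt0P; exists [ffun=> ord0].
pose chi T k := expi (pi * \tr (ratmx T *m X k)).
have ortho T T' : T \in G1 -> T' \in G1 -> T != T' ->
    \sum_k chi T k * (chi T' k)^*%C = 0.
  move=> TG TG' neq.
  have hT : twice_integral T by apply: Hc; move: TG; rewrite G1E => /andP[].
  have hT' : twice_integral T' by apply: Hc; move: TG'; rewrite G1E => /andP[].
  pose D (p : 'I_g * 'I_g) : R := 2 * ratmx T p.1 p.2 - 2 * ratmx T' p.1 p.2.
  have DE p : exists d : int, D p = d%:~R.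
    have [Z /matrixP/(_ p.1 p.2) ZE] := twice_integral_ratmx hT.
    have [Z' /matrixP/(_ p.1 p.2) ZE'] := twice_integral_ratmx hT'.
    exists (Z p.1 p.2 - Z' p.1 p.2); rewrite intrB /D; move: ZE.
    by rewrite mxE [RHS]mxE => ->; move: ZE'; rewrite mxE [RHS]mxE => ->.
  have [i [j ij]] : exists i j, T i j != T' i j.
    apply/not_existsP => H; case/eqP: neq; apply/matrixP => i j; apply/eqP/negPn/negP => h.
    by apply: (H i); exists j.
  transitivity (\sum_(k : J) \prod_(p : 'I_g * 'I_g)
      expi (2 * pi * (D p / N%:R) * (k p : nat)%:R)).
    apply: eq_bigr => k _; rewrite /chi -expiN -expiD -expi_sum.
    case: (hT) => sT _; case: (hT') => sT' _.
    rewrite !trX// -sumrB; congr expi; apply: eq_bigr => p _.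
    by rewrite /D; ring.
  rewrite -(bigA_distr_bigA (fun p (m : 'I_N) => expi (2 * pi * (D p / N%:R) * (m : nat)%:R))).
  rewrite (bigD1 (i, j))//=; have [q qE] := DE (i, j).
  rewrite qE sum_expi_eq0 ?mul0r//; apply/andP; split.
    rewrite absz_gt0; apply/eqP => q0; case/eqP: ij.
    move: qE; rewrite q0 /D /= => /eqP; rewrite subr_eq0 => /eqP /mulfI.
    have n2 : 2 != 0 :> R by rewrite pnatr_eq0.
    by move=> /(_ n2); rewrite !mxE => /fmorph_inj.
  rewrite -(ltr_nat R) natr_absz intr_norm -qE.
  apply: le_lt_trans NS; rewrite /D [leRHS]mulr_natl mulr2n.
  by apply: le_trans (ler_normB _ _) _; apply: lerD; exact: entry.
have := @bessel_finite R _ J G1 c chi (K + d) J0.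
move=> /(_ (fun _ _ => normc_expi _) ortho) HB.
have : \sum_(T <- G1) normc (c T) ^+ 2 <= (K + d) ^+ 2.
  apply: HB => k; have [s hs sK] := HK _ (Xs k).
  rewrite -(sum_G1 _ (fun T => c T * chi T k)); last by move=> T ->; rewrite mul0r.
  have := has_sum_approx hs (HA' (X k)) (fsubsetUr A A0); rewrite -/G.
  rewrite -/(chi _ k); set t := \sum_(T <- G) _ => ht.
  rewrite -[t](subKr s); apply: le_trans (normcD_le _ _) _.
  by rewrite normcN lerD.
rewrite -(sum_G1 _ (fun T => normc (c T) ^+ 2)); last first.
  by move=> T ->; rewrite ComplexField.Normc.normc0 expr0n.
move=> hG; have hA : \sum_(T <- A) normc (c T) ^+ 2 <= (K + d) ^+ 2.
  have GE : G = (A `|` (A0 `\` A))%fset.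
    by apply/fsetP => T; rewrite !inE; case: (T \in A).
  apply: le_trans hG; rewrite GE sum_fsetU; last first.
    by apply/fdisjointP => T TA; rewrite !inE TA.
  by rewrite lerDl; apply: sumr_ge0 => T _; exact: sqr_ge0.
have Kd : 0 <= K + d by rewrite addr_ge0// ltW.
by rewrite -(ger0_norm Kd) -sqrtr_sqr ler_wsqrtr.
Qed.

End FourierExpansions.

(** * The Petersson norm and genus at most five *)

Section Numerics.
Variable R : realType.

Lemma sin_le_id (x : R) : 0 <= x -> sin x <= x.
Proof.
rewrite le_eqVlt => /orP[/eqP <-|x0]; first by rewrite sin0.
have [c cI] := @MVT R sin cos 0 x x0 (fun y _ => is_derive_sin y)
  (continuous_subspaceT (@continuous_sin R)).
rewrite sin0 !subr0 => ->.
by rewrite ler_piMl ?cos_le1// ltW.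
Qed.

(** From [0 = cos(pi / 2) = 1 - 2 sin(pi / 4)^2] and [sin x <= x] one gets [pi^2 >= 8], and 2.8
    squared is 7.84. *)
Lemma pi_gt_14_5 : 14 / 5 < pi :> R.
Proof.
have p0 := pi_gt0 R; pose s := sin (pi / 4 : R).
have s1 : s <= pi / 4 by apply: sin_le_id; rewrite divr_ge0// ltW.
have p2 := pi_ge2 R.
have s0 : 0 <= s.
  apply: sin_ge0_pi; apply/andP; split; first by rewrite divr_ge0// ltW.
  by rewrite ler_pdivrMr//; lra.
have : cos (pi / 2 : R) = 1 - s ^+ 2 *+ 2.
  have -> : pi / 2 = (pi / 4) *+ 2 :> R by rewrite mulr2n; field.
  by rewrite cos_mulr2n cos2sin2 mulrnBl addrAC mulr2n addrK.
rewrite cos_pihalf => h; have : s ^+ 2 <= (pi / 4) ^+ 2 by rewrite lerXn2r ?nnegrE//; lra.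
by nra.
Qed.

(** Here 257/250 is [1 + 2.8 / 100], a lower bound for [exp(pi / 100)]. *)
Lemma expR_descent_le : expR (- (pi * (1 / 100))) <= (257 / 250)^-1 :> R.
Proof.
have p : 0 < 257 / 250 :> R by lra.
rewrite expRN lef_pV2; [|exact: expR_gt0|exact: p].
by apply: le_trans (expR_ge1Dx _); have := pi_gt_14_5; lra.
Qed.

Lemma height_bound (l m : R) : l <= 9 / 4 -> m <= l / (43 / 50) -> m <= 131 / 50.
Proof. by lra. Qed.

(* [(1 - 1 / 2000) (1 - 2.62 / 100) 1.028 > 1]. *)
Lemma descent_contradiction (S w D m : R) : 0 < S -> 0 < D -> m <= 131 / 50 ->
  S - S / 50 / 40 < w * D ->
  w <= S / (D * (1 - 1 / 100 * m)) * expR (- (pi * (1 / 100))) -> False.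
Proof.
move=> S0 D0 hm near H; have e1 := expR_descent_le.
have k0 : 0 < 1 - 1 / 100 * m by lra.
have h1 : w * D * (1 - 1 / 100 * m) <= S * (257 / 250)^-1.
  apply: le_trans (_ : S * expR (- (pi * (1 / 100))) <= _); last by rewrite ler_pM2l.
  have cancel (q z : R) : 0 < q -> S * z = S / (D * q) * z * D * q.
    by move=> q0; field; rewrite !gt_eqF.
  by rewrite (cancel _ _ k0) ler_pM2r// ler_pM2r.
have h2 : (S - S / 50 / 40) * (1 - 1 / 100 * m) <= w * D * (1 - 1 / 100 * m).
  by rewrite ler_pM2r// ltW.
have h3 : (S - S / 50 / 40) * (1 - 131 / 50 / 100) <= (S - S / 50 / 40) * (1 - 1 / 100 * m).
  by rewrite ler_pM2l; lra.
move: h1 h2 h3; move: (_ * (1 - 1 / 100 * m)) (w * D * _) => x y.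
have -> : (257 / 250 : R)^-1 = 250 / 257 by field.
by lra.
Qed.

End Numerics.

Section NoCuspForm.
Variables (R : realType) (g : nat) (f : 'M[R[i]]_g -> R[i]).
Local Notation C := R[i].
Local Notation normc := (@ComplexField.Normc.normc R).
Hypothesis g0 : (0 < g)%N.
Hypothesis cusp_f : cusp_form 2 f.
Implicit Types (M N : 'M[int]_(g + g)) (tau : 'M[C]_g).

Definition red2 m n (M : 'M[int]_(m, n)) : 'M['F_2]_(m, n) :=
  map_mx (fun z : int => z%:~R : 'F_2) M.

Lemma cusp_expansion M : Sp M ->
  exists2 a, fourier_expansion (slash 2 f M) a & cuspidal a.
Proof.
move=> sM; have [_ /(_ M sM)[a Ha pa]] := cusp_f.
by exists a => // T a0; split; [case: Ha => h _; exact: h | exact: pa].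
Qed.

Lemma normc_gt0 (z : C) : z != 0 -> 0 < normc z.
Proof.
move=> z0; rewrite lt_neqAle normc_ge0 andbT eq_sym.
by apply: contra_neq z0; exact: ComplexField.Normc.eq0_normc.
Qed.

Lemma slash_coset M N tau : Sp M -> Sp N -> red2 M = red2 N ->
  siegel_half_space tau -> slash 2 f M tau = slash 2 f N tau.
Proof.
move=> sM sN MN hT; pose G := N *m sp_inv M.
have sG : Sp G by apply: SpM => //; exact: Sp_inv.
have G2 : Gamma2 G.
  split=> //; have -> : 1%:M = red2 (M *m sp_inv M) by rewrite sp_Minv// /red2 map_mx1.
  by rewrite /red2 /G !map_mxM -!/(red2 _) MN.
have NE : N = G *m M by rewrite /G -mulmxA sp_invM// mulmx1.
rewrite NE slashM// /slash; congr (_ * _).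
have hM := siegel_act_half_space sM hT; have [[_ inv _] _] := cusp_f.
rewrite (inv _ _ G2 hM).
have uG := automorphy_unit sG hM.
by rewrite mulKf// expf_neq0// -unitfE -unitmxE.
Qed.

Lemma slash1 tau : slash 2 f 1%:M tau = f tau.
Proof.
have E : 1%:M = translation_mx (0 : 'M[int]_g) by rewrite /translation_mx -scalar_mx_block.
rewrite /slash E automorphy_translation act_translation det1 expr1n invr1 mul1r.
by rewrite intC0 addr0.
Qed.

(** The determinant carries half the weight as exponent, hence the exponent one. *)
Definition petersson M tau : R := normc (slash 2 f M tau) * \det (immx tau).

Lemma peterssonM M N tau : Sp M -> Sp N -> siegel_half_space tau ->
  petersson (M *m N) tau = petersson M (siegel_act N tau).
Proof.
move=> sM sN hT; rewrite /petersson slashM// (det_immx_act sN hT).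
have uN := automorphy_unit sN hT; set d := \det (automorphy_mx N tau).
have d0 : d != 0 by rewrite -unitfE -unitmxE.
have n0 := normc_gt0 d0.
rewrite ComplexField.Normc.normcM ComplexField.Normc.normcV expr2 ComplexField.Normc.normcM.
by field; rewrite gt_eqF.
Qed.

Lemma petersson_reduce l : reduction g l -> exists c : R, forall M tau, Sp M ->
  siegel_half_space tau -> exists M' tau', [/\ Sp M', siegel_half_space tau',
    petersson M tau = petersson M' tau', \tr (invmx (immx tau')) <= c
    & forall i : 'I_g, i.+1 = g -> invmx (immx tau') i i <= l / (43 / 50)].
Proof.
move=> /siegel_reduction[c Hc]; exists (\sum_(i < g) c) => M tau sM hT.
have [N sN [H1 H2]] := Hc tau hT.
have sN' := Sp_inv sN.
exists (M *m sp_inv N), (siegel_act N tau); split=> //.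
- exact: SpM.
- exact: siegel_act_half_space.
- rewrite -peterssonM//; last exact: SpM.
  by rewrite -mulmxA sp_invM// mulmx1.
- exact: ler_sum.
Qed.

(** After reduction [Im tau - k] is positive definite for a fixed [k], where [fourier_bound] applies
    to each [f|M]. By [slash_coset] these are finitely many functions, indexed by matrices over
    ['F_2], and the sum of their bounds serves for all. *)
Lemma petersson_bounded : exists B : R, forall M tau, Sp M ->
  siegel_half_space tau -> petersson M tau <= B.
Proof.
have [l Hl] : exists l : R, reduction g l.
  by case: g g0 => // n _; exact: reduction_exists.
have [c Hc] := petersson_reduce Hl.
pose k : R := (`|c| + 1)^-1.
have c1 : 0 < `|c| + 1 by rewrite ltr_wpDl.
have k0 : 0 < k by rewrite invr_gt0.
have class (x : 'M['F_2]_(g + g)) : exists K : R, forall M tau, Sp M -> red2 M = x ->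
    siegel_half_space tau -> pos_def (immx tau - k%:M) -> petersson M tau <= K.
  have [[M [sM Mx]]|H] := pselect (exists M, Sp M /\ red2 M = x).
    have [a Ha ca] := cusp_expansion sM.
    have [K HK] := fourier_bound g0 Ha ca k0.
    exists K => N tau sN Nx hT pY; rewrite /petersson.
    by rewrite (slash_coset sN sM)// ?Nx//; exact: HK.
  by exists 0 => N tau sN Nx; case: H; exists N.
have [K HK] := choice class.
exists (\sum_x `|K x|) => M tau sM hT.
have [M' [tau' [sM' hT' -> tr' _]]] := Hc M tau sM hT.
apply: le_trans (HK (red2 M') M' tau' sM' erefl hT' _) _.
  apply: pos_def_sub_scalar; first by case: hT'.
  rewrite /k mulrC ltr_pdivrMr// mul1r; apply: le_lt_trans tr' _.
  by apply: le_lt_trans (ler_norm _) _; rewrite ltrDl.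
rewrite (bigD1 (red2 M'))//=; apply: le_trans (ler_norm _) _.
by rewrite lerDl sumr_ge0.
Qed.

Lemma vanish_small tau : (g <= 5)%N -> siegel_half_space tau -> f tau = 0.
Proof.
move=> g5 hT; apply/eqP/negPn/negP => f0.
have [B HB] := petersson_bounded.
pose E : set R := [set x | exists M s, [/\ Sp M, siegel_half_space s & x = petersson M s]].
have EP M s : Sp M -> siegel_half_space s -> E (petersson M s) by move=> sM hs; exists M, s.
have sE : has_sup E.
  split; first by exists (petersson 1%:M tau); apply: EP => //; exact: Sp1.
  by exists B => _ [M [s [sM hs ->]]]; exact: HB.
pose S := sup E.
have ub M s : Sp M -> siegel_half_space s -> petersson M s <= S.
  by move=> sM hs; apply: sup_upper_bound => //; exact: EP.
have S0 : 0 < S.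
  apply: lt_le_trans (ub _ _ (Sp1 g) hT).
  by rewrite /petersson slash1 mulr_gt0 ?normc_gt0// pos_def_det//; case: hT.
(* The tolerance is [S / 2000], well below the relative gain of the descent step. *)
have e0 : 0 < S / 50 / 40 by rewrite !divr_gt0.
have [_ [M0 [s0 [sM0 hs0 ->]]] near] := sup_adherent e0 sE.
have [l l94 Hl] : exists2 l : R, l <= 9 / 4 & reduction g l.
  by case: g g0 g5 => // n _ n5; exact: reduction_small.
have [c Hc] := petersson_reduce Hl.
have [M [s [sM hs PE _ last]]] := Hc M0 s0 sM0 hs0; rewrite PE -/S in near.
have [i iE] : exists i : 'I_g, i.+1 = g.
  by case: g g0 => // n _; exists ord_max.
have {last} mu := last i iE; set m := invmx (immx s) i i in mu.
have pY : pos_def (immx s) by case: hs.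
have m0 : 0 < m by exact: pos_def_diag (pos_def_inv pY).
have hm := height_bound l94 mu.
have pe : pos_def (immx s - (1 / 100) *: delta_mx i i).
  by apply: pos_def_sub_delta => //; rewrite -/m; lra.
have [a Ha ca] := cusp_expansion sM.
have d0 := pos_def_det pY; have d1 := pos_def_det pe.
have e100 : 0 < 1 / 100 :> R by rewrite divr_gt0.
(* All shifted points have the same imaginary part, so the bound [S] for [petersson M] becomes one
   bound for [|f|M|] at each of them. *)
have H := cuspidal_descent (K := S / \det (immx s - (1 / 100) *: delta_mx i i))
  Ha ca hs e100 pe _.
apply: (descent_contradiction S0 d0 hm near).
rewrite -[_ * (1 - _)]det_sub_delta ?pos_def_unit//; apply: H => x.
rewrite ler_pdivlMr//.
have := ub M (s + (x -i* (1 / 100)) *: delta_mx i i) sM (siegel_shift x hs pe).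
by rewrite /petersson immx_shift.
Qed.

End NoCuspForm.

(** * Genus at least six *)

Section LargeGenus.
Variables (R : realType) (n : nat) (f : 'M[R[i]]_(1 + n) -> R[i]).
Local Notation C := R[i].
Local Notation g := (1 + n)%N.
Local Notation normc := (@ComplexField.Normc.normc R).
Hypothesis n5 : (5 <= n)%N.
Hypothesis cusp_f : cusp_form 2 f.

Definition int_congr (U : 'M[int]_g) (T : 'M[rat]_g) : 'M[rat]_g :=
  (map_mx intr U)^T *m T *m map_mx intr U.

Lemma int_congrM U V T : int_congr V (int_congr U T) = int_congr (U *m V) T.
Proof. by rewrite /int_congr map_mxM trmx_mul !mulmxA. Qed.

Lemma int_congr1 T : int_congr 1%:M T = T.
Proof. by rewrite /int_congr map_mx1 trmx1 mul1mx mulmx1. Qed.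

Lemma ratmx_int_congr U T :
  ratmx R (int_congr U T) = (intmx R U)^T *m ratmx R T *m intmx R U.
Proof.
have e : map_mx ratr (map_mx intr U : 'M[rat]_g) = intmx R U.
  by apply/matrixP=> i j; rewrite !mxE ratr_int.
by rewrite /ratmx /int_congr !map_mxM -map_trmx e.
Qed.

Lemma twice_integral_congr U T : twice_integral T -> twice_integral (int_congr U T).
Proof.
move=> [sT [Z ZE]]; split; first by rewrite /int_congr !trmx_mul trmxK sT mulmxA.
exists (U^T *m Z *m U); rewrite !map_mxM -map_trmx -ZE /int_congr.
by rewrite -scalemxAr -scalemxAl.
Qed.

Lemma has_sum_reindex (I : choiceType) (x : I -> C) s (p q : I -> I) :
  cancel p q -> cancel q p -> has_sum x s -> has_sum (x \o p) s.
Proof.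
move=> pK qK H e e0; have [A0 HA] := H e e0.
exists (q @` A0)%fset => A sA; have := HA (p @` A)%fset.
rewrite big_imfset /=; last by move=> i j _ _; exact: (can_inj pK).
apply; apply/fsubsetP => i iA; apply/imfsetP; exists (q i) => //=.
by apply: (fsubsetP sA); apply/imfsetP; exists i.
Qed.

Section Invariance.
Variables (a : 'M[rat]_g -> C).
Hypothesis Fa : fourier_expansion f a.
Hypothesis ca : cuspidal a.

Lemma levi_invariance U tau : U \in unitmx -> red2 U = 1%:M ->
  siegel_half_space tau -> f (intC R U *m tau *m (intC R U)^T) = f tau.
Proof.
move=> uU U2 hT; have sL := Sp_levi uU.
have L2 : Gamma2 (levi_mx U).
  split=> //; rewrite /levi_mx map_block_mx !map_mx0 -!/(red2 _) U2.
  have -> : red2 (invmx U)^T = 1%:M.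
    have : red2 (invmx U) = 1%:M.
      by rewrite -[LHS]mul1mx -U2 /red2 -map_mxM mulmxV// map_mx1.
    by rewrite /red2 -map_trmx => ->; rewrite trmx1.
  by rewrite -scalar_mx_block.
have [[_ inv _] _] := cusp_f; rewrite -act_levi// inv//.
by rewrite det_automorphy_levi// mul1r.
Qed.

(** Uniqueness of Fourier coefficients in the guise of [fourier_bessel] with bound 0: by
    [levi_invariance] the series with coefficients [a(T[U]) - a(T)] sums to zero at every
    [X + i]. *)
Lemma coefficient_invariance U T : U \in unitmx -> red2 U = 1%:M ->
  a (int_congr U T) = a T.
Proof.
move=> uU U2; pose V := invmx U.
have VK T' : int_congr V (int_congr U T') = T'.
  by rewrite int_congrM mulmxV// int_congr1.
have UK T' : int_congr U (int_congr V T') = T'.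
  by rewrite int_congrM mulVmx// int_congr1.
pose c T' := a (int_congr U T') - a T'.
have c2 T' : c T' != 0 -> twice_integral T'.
  have [e1|a1 _] := eqVneq (a T') 0; last first.
    by apply: half_integral_twice; have [] := ca a1.
  have [e2|a2 _] := eqVneq (a (int_congr U T')) 0.
    by rewrite /c e1 e2 subrr eqxx.
  rewrite -(VK T'); apply: twice_integral_congr.
  by apply: half_integral_twice; have [] := ca a2.
pose b T' := c T' * (expR (- (pi * \tr (ratmx R T'))))%:C.
have hb (X : 'M[R]_g) : X^T = X ->
    exists2 s, has_sum (fun T' => b T' * expi (pi * \tr (ratmx R T' *m X))) s & normc s <= 0.
  move=> sX; pose tau : 'M[C]_g := cmx X + 'i *: cmx 1%:M.
  have hT : siegel_half_space tau.
    split; first by rewrite linearD linearZ /= -!cmx_tr sX trmx1.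
    rewrite -/(immx _) immx_cmx; split; first exact: trmx1.
    by move=> v v0; rewrite -/(qf _ _) qf1 sqnorm_gt0.
  have uV : V \in unitmx by rewrite unitmx_inv.
  have V2 : red2 V = 1%:M.
    by rewrite -[LHS]mul1mx -U2 /red2 -map_mxM mulmxV// map_mx1.
  have h1 := fourier_has_sum Fa hT.
  have hT2 : siegel_half_space (intC R V *m tau *m (intC R V)^T).
    by rewrite -act_levi//; apply: siegel_act_half_space => //; exact: Sp_levi.
  have h2 := has_sum_reindex VK UK (fourier_has_sum Fa hT2).
  rewrite levi_invariance// in h2.
  have h3 := has_sumB h2 h1; rewrite subrr in h3.
  exists 0; last by rewrite ComplexField.Normc.normc0.
  move: h3; congr has_sum; apply/funext => T' /=.
  have tV : \tr (map_mx ratr (int_congr U T') *m (intC R V *m tau *m (intC R V)^T))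
      = \tr (map_mx ratr T' *m tau) :> C.
    have e (W : 'M[int]_g) : map_mx ratr (map_mx intr W : 'M[rat]_g) = intC R W.
      by apply/matrixP=> i j; rewrite !mxE ratr_int.
    have UV : intC R U *m intC R V = 1%:M.
      by rewrite /intC -map_mxM mulmxV// map_mx1.
    rewrite /int_congr !map_mxM -map_trmx e !mulmxA -[_ *m intC R U *m _]mulmxA UV.
    by rewrite mulmx1 mxtrace_mulC !mulmxA -trmx_mul UV trmx1 mul1mx.
  have fE : fterm a (intC R V *m tau *m (intC R V)^T) (int_congr U T')
     = a (int_congr U T') * cexp (0 +i* pi * \tr (map_mx ratr T' *m tau)).
    by rewrite /fterm tV.
  rewrite fE /fterm -mulrBl -/(c T').
  have := ftermE c tau T'; rewrite /fterm => ->.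
  by rewrite /b immx_cmx remx_cmx mulmx1 mulrA.
have b2 T' : b T' != 0 -> twice_integral T'.
  by move=> b0; apply: c2; apply: contra_neq b0; rewrite /b => ->; rewrite mul0r.
have := fourier_bessel b2 hb [fset T]%fset.
rewrite big_seq_fset1 expr0n /= => h.
have : normc (b T) = 0.
  by apply/eqP; rewrite -sqrf_eq0 eq_le h sqr_ge0.
move=> /ComplexField.Normc.eq0_normc/eqP; rewrite mulf_eq0 => /orP[|].
  by rewrite subr_eq0 => /eqP.
by rewrite -(rmorph0 (real_complex R)) (inj_eq (@complexI R)) gt_eqF// expR_gt0.
Qed.

Lemma hecke_bessel : exists2 B : R, 0 <= B & forall (Y : 'M[R]_g) (A : {fset 'M[rat]_g}),
  pos_def Y -> \sum_(T <- A) (normc (a T) * expR (- (pi * \tr (ratmx R T *m Y)))) ^+ 2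
  <= (B / \det Y) ^+ 2.
Proof.
have [B HB] := petersson_bounded (ltn0Sn n) cusp_f.
exists `|B| => // Y A pY; have d0 := pos_def_det pY.
pose c T := a T * (expR (- (pi * \tr (ratmx R T *m Y))))%:C.
have nE T : normc (a T) * expR (- (pi * \tr (ratmx R T *m Y))) = normc (c T).
  by rewrite ComplexField.Normc.normcM normc_real ger0_norm// expR_ge0.
under eq_bigr => T _ do rewrite nE.
apply: fourier_bessel => [T c0|X sX].
  have a0 : a T != 0 by apply: contra_neq c0; rewrite /c => ->; rewrite mul0r.
  by apply: half_integral_twice; have [] := ca a0.
pose tau : 'M[C]_g := cmx X + 'i *: cmx Y.
have hT : siegel_half_space tau.
  split; first by rewrite linearD linearZ /= -!cmx_tr sX (pos_def_sym pY).
  by rewrite -/(immx _) immx_cmx.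
exists (f tau).
  move: (fourier_has_sum Fa hT); congr has_sum; apply/funext => T.
  by rewrite ftermE immx_cmx remx_cmx mulrA.
rewrite ler_pdivlMr//; apply: le_trans (ler_norm B).
by have := HB _ _ (Sp1 g) hT; rewrite /petersson slash1 immx_cmx.
Qed.

Definition shear (m : 'rV[int]_n) : 'M[int]_g := block_mx 1%:M 0 (2 *: m^T) 1%:M.

Lemma shear_unit m : shear m \in unitmx.
Proof. by rewrite unitmxE det_lblock !det1 mulr1. Qed.

Lemma shear_red2 m : red2 (shear m) = 1%:M.
Proof.
rewrite /red2 /shear map_block_mx !map_mx1 map_mx0 (scalar_mx_block 1 n 1).
congr block_mx; apply/matrixP=> i j; rewrite !mxE intrM.
by rewrite (_ : (2%:~R : 'F_2) = 0) ?mul0r//; apply: val_inj.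
Qed.

Lemma intmx_shear m : intmx R (shear m) = block_mx 1%:M 0 (2 *: (intmx R m)^T) 1%:M.
Proof.
rewrite /intmx map_block_mx !map_mx1 map_mx0; congr block_mx.
by apply/matrixP=> i j; rewrite !mxE intrM.
Qed.

Lemma qf_shear T m (x : R) (w : 'rV[R]_n) :
  qf (ratmx R (int_congr (shear m) T)) (row_mx x%:M w) =
  qf (ratmx R T) (row_mx x%:M ((2 * x) *: intmx R m + w)).
Proof.
rewrite ratmx_int_congr -{2}[intmx R (shear m)]trmxK qf_congr intmx_shear; congr qf.
rewrite tr_block_mx !trmx1 trmx0 linearZ /= trmxK mul_row_block !mulmx1 mulmx0 addr0.
by rewrite mul_scalar_mx scalerA mulrC.
Qed.

(** Comparing values at suitable vectors gives [T(e + w) = T(e) = T(e - w)] for [w = (0, 2 d)];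
    adding yields [T(w) = 0], hence [w = 0]. *)
Lemma shear_inj T m m' : pos_def (ratmx R T) ->
  int_congr (shear m) T = int_congr (shear m') T -> m = m'.
Proof.
move=> pT H; pose d := intmx R m - intmx R m'.
pose e : 'rV[R]_g := row_mx 1%:M 0; pose w : 'rV[R]_g := row_mx 0 (2 *: d).
have h1 : qf (ratmx R T) (e + 1 *: w) = qf (ratmx R T) e.
  have := qf_shear T m 1 (- (2 *: intmx R m')).
  rewrite H qf_shear mulr1 subrr -/e => ->; congr qf.
  by rewrite scale1r /e /w add_row_mx addr0 add0r scalerBr.
have h2 : qf (ratmx R T) (e + (-1) *: w) = qf (ratmx R T) e.
  have := qf_shear T m' 1 (- (2 *: intmx R m)).
  rewrite -H qf_shear mulr1 subrr -/e => ->; congr qf.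
  by rewrite scaleN1r /e /w opp_row_mx add_row_mx oppr0 addr0 add0r -scalerN opprB scalerBr.
have w0 : w = 0.
  apply/eqP/negPn/negP => w0; have := pos_def_gt0 pT w0.
  by move: h1 h2; rewrite !qfD ?pos_def_sym//; lra.
have d0 : 2 *: d = 0.
  by have := row_mxKr (0 : 'rV[R]_1) (2 *: d); rewrite -/w w0 => <-; apply/matrixP=> i j; rewrite !mxE.
apply/eqP; rewrite -subr_eq0; apply/eqP/(@intmx_eq0 R).
have -> : intmx R (m - m') = d by rewrite /d /intmx map_mxB.
by apply/eqP; move/eqP: d0; rewrite scaler_eq0 pnatr_eq0.
Qed.

Definition squeeze (v : R) : 'M[R]_g := block_mx v%:M 0 0 1%:M.

Lemma trace_squeeze (S : 'M[R]_g) v :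
  \tr (S *m squeeze v) = v * S 0 0 + \sum_i S (rshift 1 i) (rshift 1 i).
Proof.
rewrite -{1}[S]submxK mulmx_block !mulmx0 !mulmx1 addr0 add0r mxtrace_block.
congr (_ + _).
  rewrite mul_mx_scalar linearZ /= /mxtrace big_ord1 !mxE; congr (_ * S _ _); exact: val_inj.
by rewrite add0r; apply: eq_bigr => i _; rewrite !mxE.
Qed.

(** The shear changes only the first diagonal entry of [T]. That entry grows at most like [L^2], and
    the weight [v] in [squeeze v] compensates this. *)
Lemma trace_shear T (m : 'rV[int]_n) v (L : R) : pos_def (ratmx R T) -> 0 < v -> v <= 1 ->
  v * L ^+ 2 <= 1 -> (forall i, `|(m 0 i)%:~R| <= L) ->
  \tr (ratmx R (int_congr (shear m) T) *m squeeze v)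
  <= \tr (ratmx R T) * (2 + 4 * n%:R).
Proof.
move=> pT v0 v1 vL mL; rewrite trace_squeeze.
have t0 : 0 <= \tr (ratmx R T).
  by apply: sumr_ge0 => i _; exact/ltW/pos_def_diag.
have diag i : ratmx R (int_congr (shear m) T) (rshift 1 i) (rshift 1 i)
    = ratmx R T (rshift 1 i) (rshift 1 i).
  have dE : delta_mx 0 (rshift 1 i) = row_mx (0%:M : 'M[R]_1) (delta_mx 0 i) :> 'rV[R]_g.
    rewrite delta_mx_rshift; congr row_mx.
    by apply/matrixP=> x y; rewrite !mxE mul0rn.
  by rewrite -!qf_delta dE qf_shear mulr0 scale0r add0r.
have first : ratmx R (int_congr (shear m) T) 0 0 <= \tr (ratmx R T) * (1 + 4 * (n%:R * L ^+ 2)).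
  have dE : delta_mx 0 0 = row_mx (1%:M : 'M[R]_1) 0 :> 'rV[R]_g.
    have -> : 1%:M = delta_mx 0 0 :> 'M[R]_1.
      by apply/matrixP=> i j; rewrite !ord1 !mxE.
    rewrite -delta_mx_lshift; congr delta_mx; exact: val_inj.
  rewrite -qf_delta dE qf_shear mulr1 addr0.
  apply: le_trans (qf_le_tr _ pT) _; rewrite ler_wpM2l// sqnorm_row_mx.
  have -> : sqnorm (1%:M : 'rV[R]_1) = 1 by rewrite /sqnorm big_ord1 mxE eqxx expr1n.
  rewrite lerD2l /sqnorm.
  have -> : 4 * (n%:R * L ^+ 2) = \sum_(i < n) 4 * L ^+ 2.
    by rewrite sumr_const card_ord -[RHS]mulr_natl; ring.
  apply: ler_sum => i _; rewrite !mxE exprMn.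
  have -> : 2 ^+ 2 = 4 :> R by rewrite expr2 -natrM.
  rewrite ler_pM2l//; rewrite -real_normK ?num_real//.
  by apply: lerXn2r; rewrite ?nnegrE// (le_trans _ (mL i)).
have rest : \sum_i ratmx R (int_congr (shear m) T) (rshift 1 i) (rshift 1 i) <= \tr (ratmx R T).
  rewrite [leRHS]big_split_ord /=.
  under eq_bigr => i _ do rewrite diag.
  by rewrite lerDr; apply: sumr_ge0 => i _; exact/ltW/pos_def_diag.
have n0 : 0 <= n%:R :> R by [].
have h1 : v * ratmx R (int_congr (shear m) T) 0 0 <= \tr (ratmx R T) * (1 + 4 * n%:R).
  apply: le_trans (_ : v * (\tr (ratmx R T) * (1 + 4 * (n%:R * L ^+ 2))) <= _).
    by rewrite ler_pM2l.
  rewrite mulrCA ler_wpM2l// mulrDr mulr1 lerD//.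
  have -> : v * (4 * (n%:R * L ^+ 2)) = 4 * n%:R * (v * L ^+ 2) by ring.
  by rewrite -[leRHS]mulr1 ler_wpM2l// mulr_ge0.
apply: le_trans (lerD h1 rest) _.
by rewrite -[X in _ + X]mulr1 -mulrDr; apply: ler_wpM2l => //; lra.
Qed.

Lemma coefficient_eq0 T : a T = 0.
Proof.
apply/eqP/negPn/negP => a0; have [_ pT] := ca a0.
have [B B0 HB] := hecke_bessel.
pose K := \tr (ratmx R T) * (2 + 4 * n%:R).
(* A lower bound for each squared term belonging to a sheared matrix, since [K] bounds all their
   traces against [squeeze v]. *)
pose al := (normc (a T) * expR (- (pi * K))) ^+ 2.
have al0 : 0 < al by rewrite exprn_gt0// mulr_gt0 ?expR_gt0// normc_gt0.
have bound (L : nat) : (0 < L)%N -> L%:R * al <= B ^+ 2.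
  move=> L0; have L0' : 0 < L%:R :> R by rewrite ltr0n.
  have L1 : 1 <= L%:R :> R by rewrite ler1n.
  pose v : R := (L%:R ^+ 2)^-1.
  have v0 : 0 < v by rewrite invr_gt0 exprn_gt0.
  have v1 : v <= 1 by rewrite invf_le1 ?exprn_gt0// exprn_ege1.
  have pv : pos_def (squeeze v).
    apply: pos_def_block.
      split; first by rewrite tr_scalar_mx.
      by move=> x x0; rewrite -/(qf _ _) qf_scalar mulr_gt0// sqnorm_gt0.
    by split; [rewrite trmx1 | move=> x x0; rewrite -/(qf _ _) qf1 sqnorm_gt0].
  pose J := {ffun 'I_n -> 'I_L}.
  pose m (k : J) : 'rV[int]_n := \row_i (k i : nat)%:Z.
  pose A := [fset int_congr (shear (m k)) T | k in J]%fset.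
  have inj : {in J &, injective (fun k => int_congr (shear (m k)) T)}.
    move=> k k' _ _ /(shear_inj pT)/rowP E; apply/ffunP => i.
    by apply: val_inj; have := E i; rewrite !mxE => -[].
  have := HB _ A pv; rewrite big_imfset //= => H.
  have dv : \det (squeeze v) = v by rewrite /squeeze det_ublock det1 mulr1 det_scalar1.
  rewrite dv in H.
  have : (L ^ n)%:R * al <= (B / v) ^+ 2.
    apply: le_trans H.
    have -> : (L ^ n)%:R * al = \sum_(k <- enum J) al.
      rewrite big_const_seq count_predT iter_addr_0 -[RHS]mulr_natl; congr (_%:R * _).
      by rewrite -cardE card_ffun !card_ord.
    apply: ler_sum => k _; rewrite coefficient_invariance ?shear_unit ?shear_red2//.
    apply: lerXn2r; rewrite ?nnegrE ?mulr_ge0 ?normc_ge0 ?expR_ge0//.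
    rewrite ler_wpM2l ?normc_ge0// ler_expR lerN2 ler_wpM2l ?pi_ge0//.
    apply: (@trace_shear _ _ _ L%:R) => //; first by rewrite /v mulVf// gt_eqF// exprn_gt0.
    by move=> i; rewrite mxE ger0_norm// -pmulrn ler_nat ltnW.
  have -> : (B / v) ^+ 2 = B ^+ 2 * L%:R ^+ 4 by rewrite /v invrK exprMn -exprM.
  move=> h; rewrite -(ler_pM2r (exprn_gt0 4 L0')); apply: le_trans h.
  (* The inequality [L^5 <= L^n] is where genus at least six enters. *)
  rewrite mulrAC -exprS natrX ler_pM2r// ler_weXn2l//.
pose L := (Num.truncn (B ^+ 2 / al)).+1.
have := truncnS_gt (B ^+ 2 / al); rewrite -/L ltr_pdivrMr// => h.
by have := bound L (ltn0Sn _); rewrite leNgt h.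
Qed.

End Invariance.

Lemma vanish_large tau : siegel_half_space tau -> f tau = 0.
Proof.
move=> hT; have [a Ha ca] := cusp_expansion cusp_f (Sp1 g).
have Fa : fourier_expansion f a.
  case: Ha => h1 h2; split; first exact: h1.
  by move=> s hs; rewrite -(slash1 f s); exact: h2.
apply: has_sum_zero (fourier_has_sum Fa hT) _ => T.
by rewrite /fterm coefficient_eq0// mul0r.
Qed.

End LargeGenus.

Theorem theorem6p3 (R : realType) (g : nat) (hg : (1 <= g)%N) :
  ~ exists f : 'M[R[i]]_g -> R[i],
      cusp_form 2 f /\ exists2 tau, siegel_half_space tau & f tau != 0.
Proof.
move=> [f [cusp_f [tau hT /eqP]]]; apply.
have [g5|g5] := leqP g 5; first exact: (vanish_small hg cusp_f).
by case: g hg f cusp_f tau hT g5 => // n _ f cusp_f tau hT n5; exact: (@vanish_large R n f).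
Qed.
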